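(* Let $\{a_n(\omega)\}_{n\in\mathbb{Z}}$, $\omega\in\Omega$, be a translation invariant, ergodic, complex-valued stochastic process which is nondeterministic and satisfies $$\sup_{n,\omega}|a_n(\omega)|<\infty .$$ Then for a.e. $\omega$, the power series $\sum_{n=0}^\infty a_n(\omega)z^n$ has a strong natural boundary on $\partial\mathbb{D}$.
   Context: $\mathbb{D}=\{z\in\mathbb{C}: |z|<1\}$, $\partial\mathbb{D}$ is the unit circle, and an open interval $I\subset\partial\mathbb{D}$ means a nonempty open arc. A stochastic process $\{a_n(\omega)\}_{n\in\mathbb{Z}}$ is deterministic if $a_0(\omega)$ is a measurable function of $\{a_n(\omega)\}_{n=-\infty}^{-1}$ for a.e. $\omega$, and nondeterministic if it is not deterministic. Translation invariant and ergodic mean that the law of the process on two-sided sequences is invariant and ergodic under the shift $\{a_n\}\mapsto\{a_{n+1}\}$. Strong natural boundary: $f$, analytic on $\mathbb{D}$, has a strong natural boundary on $\partial\mathbb{D}$ if for every open interval $I\subset\partial\mathbb{D}$ one has $\sup_{0<r<1}\int_{e^{i\theta}\in I}|f(re^{i\theta})|\,\frac{d\theta}{2\pi}=\infty$. *)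

(* Defs.v *)
From mathcomp Require Import all_boot all_order all_algebra.
From mathcomp Require Import complex.
From mathcomp Require Import all_classical all_reals all_analysis.

Set Implicit Arguments.
Unset Strict Implicit.
Unset Printing Implicit Defensive.

Import Order.TTheory GRing.Theory Num.Theory.
Import numFieldNormedType.Exports.

Local Open Scope classical_set_scope.
Local Open Scope ring_scope.
Local Open Scope complex_scope.

(* R[i] gets its topology and normed module structure through [^o]. *)
Definition borelC (R : realType) := g_sigma_algebraType (@open R[i]^o).

Definition cylinders d (T : measurableType d) (I : Type) : set (set (I -> T)) :=
  \bigcup_(i in [set: I])
    preimage_set_system setT (fun u : I -> T => u i) measurable.

(* [I -> T] with the product sigma-algebra. *)
Definition path_space d (T : measurableType d) (I : Type) :=
  g_sigma_algebraType (@cylinders d T I).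

Section process.
Context d (Omega : measurableType d) (R : realType) (P : probability Omega R).
Variable a : int -> {RV P >-> borelC R}.

Definition sample_path (w : Omega) : path_space (borelC R) int := fun n => a n w.

Definition law : set (path_space (borelC R) int) -> \bar R :=
  pushforward P sample_path.

Definition path_shift (u : path_space (borelC R) int) :
    path_space (borelC R) int :=
  fun n => u (n + 1).

Definition translation_invariant :=
  forall B, measurable B -> law (path_shift @^-1` B) = law B.

Definition ergodic :=
  forall B, measurable B -> path_shift @^-1` B = B -> law B = 0%E \/ law B = 1%E.

Definition past (w : Omega) : path_space (borelC R) nat :=
  fun k => a (- k.+1%:Z) w.

Definition deterministic :=
  exists2 F : path_space (borelC R) nat -> borelC R,
    measurable_fun setT F & {ae P, forall w, a 0 w = F (past w)}.

Definition nondeterministic := ~ deterministic.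

End process.

Section natural_boundary.
Variable R : realType.

Definition power_series (c : nat -> R[i]) (z : R[i]) : R[i] :=
  limn (series (fun n => c n * z ^+ n : R[i]^o)).

Definition expi (t : R) : R[i] := cos t +i* sin t.

Definition analytic_on_disk (f : R[i] -> R[i]) :=
  forall z : R[i], `|z| < 1 -> derivable (f : R[i]^o -> R[i]^o) z 1.

(* No upper bound on [t - s]: the full circle is allowed as an arc. *)
Definition open_arc (I : set R[i]) :=
  exists s t : R, s < t /\ I = expi @` `]s, t[.

Definition circle_mean_on (f : R[i] -> R[i]) (I : set R[i]) (r : R) : \bar R :=
  (\int[lebesgue_measure]_(t in [set t : R | (0 <= t < 2 * pi)%R /\ I (expi t)])
     (Normc.normc (f (r%:C * expi t)) / (2 * pi))%:E)%E.

Definition strong_natural_boundary (f : R[i] -> R[i]) :=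
  analytic_on_disk f /\
  forall I, open_arc I ->
    ereal_sup [set circle_mean_on f I r | r in `]0, 1[] = +oo%E.

End natural_boundary.

(* Main.v *)
Require Import Defs.
From mathcomp Require Import all_boot all_order all_algebra.
From mathcomp Require Import complex.
From mathcomp Require Import all_classical all_reals all_analysis.
From mathcomp Require Import measurable_realfun ring lra.

Set Implicit Arguments.
Unset Strict Implicit.
Unset Printing Implicit Defensive.

Import Order.TTheory GRing.Theory Num.Theory.
Import numFieldNormedType.Exports.

Local Open Scope classical_set_scope.
Local Open Scope ring_scope.
Local Open Scope complex_scope.

(** Why the theorem is true. Suppose that the means over an arc of the modulus of
    [f], the sum of [a_n z^n], stay bounded. The idea is that the sequence [a]
    then has no spectrum on the arc in the mean, and that a stationary process
    with a gap in its spectrum can be predicted from its past.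

    Let [phi] be a bump carried by the arc. Testing [f] against [phi] times a
    trigonometric polynomial and letting the radius tend to one gives a functional
    that is bounded by the maximum of the polynomial ([pairing_local_coef_le]).
    Its coefficients [c_n], the sums over [k >= 0] of [a_k] times a Fourier
    coefficient of [phi], vanish at one end because [f] has no negative
    frequencies. A bounded functional whose coefficients vanish at one end has no
    atoms ([no_atom]), so that by Wiener's lemma ([wiener]) the coefficients
    vanish in quadratic mean at the other end. By Parseval's identity the energy
    on the arc of the partial sums of [a] is then of smaller order than their
    length ([weighted_energy_small]).

    On the other hand there are polynomials [p] with [p(0) = 1] that are as small
    as desired off the arc ([small_poly_off_arc]): the arc is a gap through which
    the origin can be connected to infinity. Filtering [a] by [p] gives the
    sequence with terms [a_n + p_1 a_(n-1) + ... + p_K a_(n-K)], whose mean square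
    is small, off the arc because [p] is and on the arc because the energy is
    ([filtered_mean_square]).

    That the mean square of the filtered path is at most a given constant is a
    shift invariant event ([small_error_event_shift]); by ergodicity it is null or
    almost sure. If it is null for some [p], then almost surely the means over the
    arc are unbounded. If it is almost sure for all [p], then by stationarity
    ([mean_sq_error_le]) the expectation of [|a_0 + p_1 a_(-1) + ... + p_K a_(-K)|^2]
    can be made as small as desired, so that [a_0] is an almost sure limit of
    linear functions of the past ([deterministic_of_predictors]), against the
    hypothesis. Countably many arcs suffice ([open_arc_rat]). *)

Local Notation normc := Normc.normc.

(** * Moduli of complex numbers and points of the unit circle *)

Section complex_modulus.
Context {R : rcfType}.
Implicit Types (x y : R) (z w u v : R[i]).

Lemma normc_ge0 z : 0 <= normc z.
Proof. by case: z => a b; exact: sqrtr_ge0. Qed.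

Lemma sqr_normc_ReIm z :
  normc z ^+ 2 = complex.Re z ^+ 2 + complex.Im z ^+ 2.
Proof. by case: z => a b; rewrite sqr_sqrtr// addr_ge0// sqr_ge0. Qed.

Lemma normc_triangle z w : normc (z + w) <= normc z + normc w.
Proof. exact: (@le_normcD R z w). Qed.

Lemma normc_opp z : normc (- z) = normc z.
Proof. exact: (@normcN R z). Qed.

Lemma normc_sub z w : normc (z - w) <= normc z + normc w.
Proof. by rewrite -(normc_opp w); exact: normc_triangle. Qed.

Lemma normc_distC z w : normc (z - w) = normc (w - z).
Proof. by rewrite -normc_opp opprB. Qed.

Lemma normc_mul z w : normc (z * w) = normc z * normc w.
Proof. exact: Normc.normcM. Qed.

Lemma normc_zero : normc (0 : R[i]) = 0.
Proof. by rewrite Normc.normc0. Qed.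

Lemma normc_one : normc (1 : R[i]) = 1.
Proof. by rewrite Normc.normc1. Qed.

Lemma normc_exp z n : normc (z ^+ n) = normc z ^+ n.
Proof.
elim: n => [|n IH]; first by rewrite !expr0 normc_one.
by rewrite !exprS normc_mul IH.
Qed.

Lemma normc_inv z : normc z^-1 = (normc z)^-1.
Proof. exact: Normc.normcV. Qed.

Lemma normc_real x : normc x%:C = `|x|.
Proof. by rewrite /Normc.normc /= expr0n addr0 sqrtr_sqr. Qed.

Lemma normc_conj z : normc (z ^*) = normc z.
Proof. by case: z => a b; rewrite /Normc.normc /= sqrrN. Qed.

Lemma normc_sum (I : Type) (r : seq I) (Q : pred I) (F : I -> R[i]) :
  normc (\sum_(i <- r | Q i) F i) <= \sum_(i <- r | Q i) normc (F i).
Proof.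
elim/big_ind2 : _ => [|a b c d h1 h2|//]; first by rewrite normc_zero.
by rewrite (le_trans (normc_triangle _ _))// lerD.
Qed.

Lemma normc_le_sum_const (n : nat) (F : nat -> R[i]) (B : R) :
  (forall i, (i < n)%N -> normc (F i) <= B) ->
  normc (\sum_(i < n) F i) <= n%:R * B.
Proof.
move=> FB; rewrite (le_trans (normc_sum _ _ _))//.
apply: (@le_trans _ _ (\sum_(i < n) B)).
  by apply: ler_sum => i _; exact: FB.
by rewrite sumr_const card_ord mulr_natl.
Qed.

Lemma normc_eq0 z : (normc z == 0) = (z == 0).
Proof.
by apply/eqP/eqP => [/Normc.eq0_normc//|->]; rewrite normc_zero.
Qed.

Lemma Re_normc_le z : complex.Re z <= normc z.
Proof.
case: z => a b; rewrite /Normc.normc /= (le_trans (ler_norm _))// -sqrtr_sqr.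
by rewrite ler_wsqrtr// lerDl sqr_ge0.
Qed.

Lemma abs_Re_le z : `|complex.Re z| <= normc z.
Proof.
case: z => a b; rewrite /Normc.normc /= -sqrtr_sqr.
by rewrite ler_wsqrtr// lerDl sqr_ge0.
Qed.

Lemma abs_Im_le z : `|complex.Im z| <= normc z.
Proof.
case: z => a b; rewrite /Normc.normc /= -sqrtr_sqr.
by rewrite ler_wsqrtr// lerDr sqr_ge0.
Qed.

Lemma normc_le_ReIm z : normc z <= `|complex.Re z| + `|complex.Im z|.
Proof.
rewrite {1}(complexE z) (le_trans (normc_triangle _ _))// normc_mul !normc_real.
suff -> : normc ('i : R[i]) = 1 by rewrite mul1r.
by rewrite /Normc.normc /= expr0n expr1n add0r sqrtr1.
Qed.

Lemma complex_ReD z w : complex.Re (z + w) = complex.Re z + complex.Re w.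
Proof. by case: z; case: w. Qed.

Lemma complex_ImD z w : complex.Im (z + w) = complex.Im z + complex.Im w.
Proof. by case: z; case: w. Qed.

Lemma mul_conjc z : z * z ^* = (normc z ^+ 2)%:C.
Proof.
rewrite sqr_normc_ReIm; case: z => a b; simpc => /=.
by congr (_ +i* _); rewrite ?expr2 /=; ring.
Qed.

Lemma ler_dist_normc z w : normc z - normc w <= normc (z - w).
Proof. by rewrite lerBlDr -{1}(subrK w z) normc_triangle. Qed.

Lemma abs_sub_normc_le z w : `|normc z - normc w| <= normc (z - w).
Proof.
have h1 := ler_dist_normc z w; have h2 := ler_dist_normc w z.
rewrite normc_distC in h2.
by rewrite ler_norml; apply/andP; split; lra.
Qed.

(** This is how a bound on a linear functional becomes a bound on the sum of the
    moduli of two of its values. *)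
Lemma phase_align z w :
  exists2 u, normc u = 1 & normc (z + u * w) = normc z + normc w.
Proof.
have [->|w0] := eqVneq w 0.
  by exists 1; rewrite ?normc_one// mulr0 addr0 normc_zero addr0.
have [->|z0] := eqVneq z 0.
  by exists 1; rewrite ?normc_one// mul1r add0r normc_zero add0r.
have nz : normc z != 0 by rewrite normc_eq0.
have nw : normc w != 0 by rewrite normc_eq0.
exists (z / w * (normc w / normc z)%:C).
  rewrite !normc_mul normc_inv normc_real ger0_norm ?divr_ge0 ?normc_ge0//.
  by rewrite mulrA mulfVK ?nw// mulfV.
have -> : z + z / w * (normc w / normc z)%:C * w =
          z * (1 + normc w / normc z)%:C.
  by rewrite rmorphD rmorph1 mulrDr mulr1 mulrAC divfK.
rewrite normc_mul normc_real ger0_norm ?addr_ge0 ?divr_ge0 ?normc_ge0//.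
by rewrite mulrDr mulr1 mulrC divfK.
Qed.

End complex_modulus.

Section unit_circle.
Context {R : realType}.
Implicit Types x y : R.

Lemma expi0 : expi (0 : R) = 1.
Proof. by rewrite /expi cos0 sin0. Qed.

Lemma expiD x y : expi (x + y) = expi x * expi y.
Proof.
rewrite /expi cosD sinD; simpc.
by congr (_ +i* _); ring.
Qed.

Lemma expiN x : expi (- x) = (expi x)^*.
Proof. by rewrite /expi cosN sinN. Qed.

Lemma normc_expi x : normc (expi x) = 1.
Proof. by rewrite /Normc.normc /= cos2Dsin2 sqrtr1. Qed.

Lemma expi_nat x n : expi (n%:R * x) = expi x ^+ n.
Proof.
elim: n => [|n IH]; first by rewrite mul0r expi0 expr0.
by rewrite -addn1 natrD mulrDl mul1r expiD IH exprD expr1.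
Qed.

Lemma expi_2pi (m : int) : expi (m%:~R * (2 * pi : R)) = 1.
Proof.
have h (n : nat) : expi (n%:R * (2 * pi : R)) = 1.
  rewrite expi_nat; have -> : expi (2 * pi : R) = 1.
    by rewrite /expi mulr_natl cos2pi sin2pi.
  by rewrite expr1n.
case: m => n; first by rewrite -pmulrn h.
by rewrite NegzE mulrNz mulNr expiN -pmulrn h conjc1.
Qed.

Lemma expi_cont (x : R) (e : R) : 0 < e ->
  \forall y \near x, normc (expi y - expi x) < e.
Proof.
move=> e0.
have e2 : 0 < e / 2 by rewrite divr_gt0.
have /cvgrPdist_lt/(_ _ e2) hc := @continuous_cos R x.
have /cvgrPdist_lt/(_ _ e2) hs := @continuous_sin R x.
near=> y.
rewrite (le_lt_trans (normc_le_ReIm _))//= (splitr e) ltrD//.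
- by rewrite distrC; near: y.
- by rewrite distrC; near: y.
Unshelve. all: by end_near. Qed.

End unit_circle.

(** * Functionals on trigonometric polynomials and Wiener's lemma *)

Section pairing.
Context {R : realType}.
Variable c : int -> R[i].
Implicit Types (p q : {poly R[i]}) (L D n : nat).

(** The action on [X^(-L) p] of the functional on trigonometric polynomials
    whose coefficients are [c]; negative frequencies are encoded by [L], so that
    ordinary polynomials suffice. *)
Definition pairing L p : R[i] := \sum_(i < size p) p`_i * c (i%:Z - L%:Z).

Lemma pairing_widen L p n : (size p <= n)%N ->
  pairing L p = \sum_(i < n) p`_i * c (i%:Z - L%:Z).
Proof.
move=> pn; rewrite /pairing.
rewrite (big_ord_widen n (fun i : nat => p`_i * c (i%:Z - L%:Z)))//.
rewrite big_mkcond /=; apply: eq_bigr => i _.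
by case: ltnP => // ip; rewrite nth_default// mul0r.
Qed.

Lemma pairingD L p q : pairing L (p + q) = pairing L p + pairing L q.
Proof.
pose n := maxn (size p) (size q).
have np : (size p <= n)%N by rewrite leq_maxl.
have nq : (size q <= n)%N by rewrite leq_maxr.
rewrite (pairing_widen _ np) (pairing_widen _ nq).
rewrite (pairing_widen _ (leq_trans (size_polyD p q) (leqnn n))).
by rewrite -big_split; apply: eq_bigr => i _; rewrite coefD mulrDl.
Qed.

Lemma pairingZ L a p : pairing L (a *: p) = a * pairing L p.
Proof.
rewrite (pairing_widen _ (size_scale_leq a p)) mulr_sumr.
by apply: eq_bigr => i _; rewrite coefZ mulrA.
Qed.

Lemma pairingB L p q : pairing L (p - q) = pairing L p - pairing L q.
Proof. by rewrite -scaleN1r pairingD pairingZ mulN1r. Qed.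

Lemma pairing_mulXn L p D : pairing (L + D) (p * 'X^D) = pairing L p.
Proof.
have s : (size (p * 'X^D)%R <= D + size p)%N.
  rewrite (leq_trans (size_polyMleq _ _))// size_polyXn addnS /=.
  by rewrite addnC.
rewrite (pairing_widen _ s) big_split_ord /= big1 ?add0r; last first.
  by move=> i _; rewrite coefMXn ltn_ord mul0r.
apply: eq_bigr => i _; rewrite coefMXn ltnNge leq_addr /= addKn.
by congr (_ * c _); rewrite !PoszD; ring.
Qed.

End pairing.

Section concentration_kernel.
Context {R : realType}.
Implicit Types (x y d : R) (M : nat).

Definition circle_bound (p : {poly R[i]}) (B : R -> R) :=
  forall x, 0 <= x <= 2 * pi -> normc p.[expi x] <= B x.

(** The value at [expi x] of the positive kernel [(1 + cos (x - y)) / 2]: its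
    powers decrease to the indicator of the point [expi y]. *)
Definition peak y x := 1 - normc (expi x - expi y) ^+ 2 / 4.

(** The same kernel multiplied by [expi x], which makes it a polynomial. *)
Definition peak_poly y : {poly R[i]} :=
  (expi y / 4) *: (1 + (expi y)^* *: 'X) ^+ 2.

Lemma dist_expi_le2 x y : normc (expi x - expi y) <= 2.
Proof. by rewrite (le_trans (normc_sub _ _))// !normc_expi. Qed.

Lemma peak_ge0 y x : 0 <= peak y x.
Proof.
have := dist_expi_le2 x y; have := normc_ge0 (expi x - expi y).
by rewrite /peak; nra.
Qed.

Lemma peak_le1 y x : peak y x <= 1.
Proof. by rewrite /peak gerBl divr_ge0// sqr_ge0. Qed.

Lemma peakX_ge0 y x M : 0 <= peak y x ^+ M.
Proof. exact: exprn_ge0 (peak_ge0 _ _). Qed.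

Lemma peakX_le1 y x M : peak y x ^+ M <= 1.
Proof. by rewrite exprn_ile1 ?peak_ge0 ?peak_le1. Qed.

Lemma peak_polyE y x : (peak_poly y).[expi x] = expi x * (peak y x)%:C.
Proof.
rewrite /peak_poly !hornerE /peak.
set u := expi x; set t := expi y.
have hu : u * u^* = 1 by rewrite mul_conjc normc_expi expr1n.
have ht : t * t^* = 1 by rewrite mul_conjc normc_expi expr1n.
have -> : (1 - normc (u - t) ^+ 2 / 4)%:C = 1 - (normc (u - t) ^+ 2)%:C / 4.
  by rewrite rmorphB rmorph1 rmorphM fmorphV rmorph_nat.
rewrite -mul_conjc [X in (u - t) * X]rmorphB /=.
have n4 : (4 : R[i]) != 0 by rewrite pnatr_eq0.
apply: (mulfI n4); rewrite -mulrA -expr2.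
have -> : 4 * (t / 4 * (1 + t^* * u) ^+ 2) = t * (1 + t^* * u) ^+ 2 by field.
have -> : 4 * (u * (1 - (u - t) * (u^* - t^*) / 4)) =
  4 * u - u * ((u - t) * (u^* - t^*)) by field.
have -> : t * (1 + t^* * u) ^+ 2 =
  t + (t * t^*) * 2 * u + (t * t^*) * t^* * u ^+ 2 by ring.
have -> : u * ((u - t) * (u^* - t^*)) =
  u * (u * u^*) - u ^+ 2 * t^* - t * (u * u^*) + u * (t * t^*) by ring.
by rewrite hu ht; ring.
Qed.

Lemma normc_peak_polyX y x M :
  normc (peak_poly y ^+ M).[expi x] = peak y x ^+ M.
Proof.
rewrite horner_exp normc_exp peak_polyE normc_mul normc_expi mul1r normc_real.
by rewrite ger0_norm ?peak_ge0.
Qed.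

Lemma normc_subX_peak_polyX y x M :
  normc ('X^M - peak_poly y ^+ M).[expi x] = 1 - peak y x ^+ M.
Proof.
rewrite hornerD hornerN hornerXn horner_exp peak_polyE exprMn.
rewrite -{1}[expi x ^+ M]mulr1 -mulrBr normc_mul normc_exp normc_expi expr1n.
have -> : 1 - (peak y x)%:C ^+ M = (1 - peak y x ^+ M)%:C.
  by move: (peak y x) => b; rewrite rmorphB rmorph1 rmorphXn.
by rewrite mul1r normc_real ger0_norm// subr_ge0 peakX_le1.
Qed.

Lemma bernoulli_subX (t : R) M : 0 <= t <= 1 -> 1 - (1 - t) ^+ M <= M%:R * t.
Proof.
move=> /andP[t0 t1]; elim: M => [|M IH]; first by rewrite expr0 subrr mul0r.
rewrite exprS -natr1.
have h : 0 <= (1 - t) ^+ M by apply: exprn_ge0; rewrite subr_ge0.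
have h1 : (1 - t) ^+ M <= 1 by rewrite exprn_ile1// ?subr_ge0// gerBl.
by nra.
Qed.

Lemma one_sub_peakX_le y x M :
  1 - peak y x ^+ M <= M%:R * (normc (expi x - expi y) ^+ 2 / 4).
Proof.
rewrite /peak; apply: bernoulli_subX.
have := dist_expi_le2 x y; have := normc_ge0 (expi x - expi y).
by move=> h0 h2; apply/andP; split; nra.
Qed.

Lemma expr_mul_linear_le1 (t : R) M : 0 <= t <= 1 ->
  (1 - t) ^+ M * (1 + M%:R * t) <= 1.
Proof.
move=> /andP[t0 t1]; elim: M => [|M IH].
  by rewrite expr0 mul0r addr0 mulr1.
have h : 0 <= (1 - t) ^+ M by apply: exprn_ge0; rewrite subr_ge0.
rewrite exprS -natr1.
have hM : 0 <= M%:R :> R by [].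
have : (1 - t) * (1 + (M%:R + 1) * t) <= 1 + M%:R * t by nra.
by move=> k; rewrite mulrC mulrA mulrC; nra.
Qed.

(** Far from the centre the power is small, and near the centre the distance
    is: the powers kill uniformly every function which vanishes at the centre at
    a linear rate. *)
Lemma dist_mul_peakX_small (e : R) : 0 < e ->
  exists M0, forall M, (M0 <= M)%N ->
    forall y x, normc (expi x - expi y) * peak y x ^+ M <= e.
Proof.
move=> e0; pose M0 := (Num.Def.truncn (2 / e / (e ^+ 2 / 4))).+1.
exists M0 => M M0M y x; set d := normc _.
have d0 : 0 <= d by exact: normc_ge0.
have d2 : d <= 2 by exact: dist_expi_le2.
have [de|ed] := leP d e.
  by rewrite (le_trans _ de)// ler_piMr// peakX_le1.
have t01 : 0 <= d ^+ 2 / 4 <= 1 by apply/andP; split; nra.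
have := expr_mul_linear_le1 M t01; rewrite -/(peak y x ^+ M).
have -> : (1 - d ^+ 2 / 4) = peak y x by [].
have b0 := peakX_ge0 y x M; set b := peak y x ^+ M in b0 *.
have MM : 2 / e / (e ^+ 2 / 4) <= M%:R.
  apply: (@le_trans _ _ M0%:R); last by rewrite ler_nat.
  by rewrite ltW// truncnS_gt.
move: MM; rewrite ler_pdivrMr ?divr_gt0 ?exprn_gt0// ler_pdivrMr// => MM H.
have : 2 <= M%:R * (d ^+ 2 / 4) * e.
  apply: (le_trans MM); rewrite ler_pM2r// ler_wpM2l// ler_pM2r ?invr_gt0//.
  by rewrite ler_sqr ?nnegrE// ltW.
set T := M%:R * (d ^+ 2 / 4) in H *.
move=> HT; have : b * 2 <= e by nra.
by nra.
Qed.

Lemma normc_1subX (v : R[i]) D : normc v = 1 ->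
  normc (1 - v ^+ D) <= D%:R * normc (1 - v).
Proof.
move=> v1; rewrite -{1}[1](expr1n _ D) subrXX normc_mul mulrC.
rewrite ler_wpM2r ?normc_ge0// -[leRHS]mulr1.
apply: (@normc_le_sum_const _ D (fun i => 1 ^+ (D.-1 - i) * v ^+ i)) => i _.
by rewrite normc_mul !normc_exp v1 normc_one !expr1n mulr1.
Qed.

End concentration_kernel.

Section wiener.
Context {R : realType}.
Variables (c : int -> R[i]) (C : R).
Hypothesis C0 : 0 <= C.
Hypothesis pairing_le : forall L p B,
  circle_bound p (fun=> B) -> normc (pairing c L p) <= C * B.
Hypothesis c_small : forall e : R, 0 < e ->
  exists n0 : nat, forall n : nat, (n0 <= n)%N -> normc (c n%:Z) <= e.
Implicit Types (p q : {poly R[i]}) (L D n N : nat).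

Lemma pairing_mulXn_small L p (e : R) : 0 < e ->
  exists D, normc (pairing c L (p * 'X^D)) <= e.
Proof.
move=> e0; pose S := \sum_(i < size p) normc p`_i.
have S0 : 0 <= S by apply: sumr_ge0 => i _; exact: normc_ge0.
have [|n0 hn0] := c_small (e := e / (S + 1)); first by rewrite divr_gt0// ltr_wpDl.
exists (n0 + L)%N.
have s : (size (p * 'X^(n0 + L))%R <= (n0 + L) + size p)%N.
  by rewrite (leq_trans (size_polyMleq _ _))// size_polyXn addnS /= addnC.
rewrite (pairing_widen _ _ s) big_split_ord /= big1 ?add0r; last first.
  by move=> i _; rewrite coefMXn ltn_ord mul0r.
apply: (@le_trans _ _ (\sum_(i < size p) normc p`_i * (e / (S + 1)))).
  rewrite (le_trans (normc_sum _ _ _))//; apply: ler_sum => i _.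
  rewrite coefMXn ltnNge leq_addr /= addKn normc_mul ler_wpM2l ?normc_ge0//.
  have -> : (n0 + L + i)%:Z - L%:Z = (n0 + i)%N%:Z by rewrite !PoszD; ring.
  by apply: hn0; rewrite leq_addr.
rewrite -mulr_suml -/S mulrA ler_pdivrMr ?ltr_wpDl// mulrC.
by rewrite ler_pM2l// lerDl.
Qed.

(** If there were an atom at [expi y], there would be polynomials [p] below
    arbitrarily high powers of the kernel on which the functional exceeds [e].
    Since [c] vanishes at infinity, [p] can be replaced with [p - (X / expi y)^D p],
    which vanishes at [expi y] and hence is essentially carried by the set where
    a much higher power of the kernel is small. These pieces have almost disjoint
    carriers, so that the functional, being bounded, cannot be large on all of
    them. *)
Lemma no_atom (y : R) (e : R) : 0 < e ->
  exists M, forall L p, circle_bound p (fun x => peak y x ^+ M) ->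
    normc (pairing c L p) <= e.
Proof.
move=> e0; apply: contrapT => /forallNP H.
have {}H M : exists L p, circle_bound p (fun x => peak y x ^+ M) /\
    e < normc (pairing c L p).
  have /existsNP[L /existsNP[p /not_implyP[h1 h2]]] := H M.
  by exists L, p; split => //; rewrite ltNge; apply/negP.
(* [1 - peak y x ^+ M] is the room taken by the first [J] pieces; the next piece
   fits into its increment, and one rotation aligns its value with theirs. *)
have step J : exists M L p, circle_bound p (fun x => 1 - peak y x ^+ M) /\
    J%:R * (e / 4) <= normc (pairing c L p).
  elim: J => [|J [M [L [p [pM pJ]]]]].
    exists 0%N, 0%N, 0; split; last by rewrite mul0r normc_ge0.
    by move=> x _; rewrite horner0 normc_zero expr0 subrr.
  have [L' [q [qM qe]]] := H M.
  have e4 : 0 < e / 4 by rewrite divr_gt0.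
  have [D qD] := pairing_mulXn_small L' q e4.
  have [|M' hM'] := @dist_mul_peakX_small R (e / 4 / ((C + 1) * (D%:R + 1))).
    by rewrite divr_gt0// mulr_gt0// ltr_wpDl.
  have {}hM' := hM' _ (leqnn _).
  pose w := ((expi y)^* ^+ D).
  have w1 : normc w = 1 by rewrite normc_exp normc_conj normc_expi expr1n.
  (* [s] vanishes at [expi y], so that [s * peak_poly y ^+ M'] is negligible. *)
  pose s := q - w *: (q * 'X^D).
  have sE x : s.[expi x] = q.[expi x] * (1 - ((expi y)^* * expi x) ^+ D).
    by rewrite /s hornerD hornerN hornerZ hornerM hornerXn exprMn -/w; ring.
  have v1 x : normc ((expi y)^* * expi x) = 1.
    by rewrite normc_mul normc_conj !normc_expi mul1r.
  have sd x : 0 <= x <= 2 * pi ->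
      normc s.[expi x] <= D%:R * normc (expi x - expi y).
    move=> xI; rewrite sE normc_mul -[leRHS]mul1r ler_pM ?normc_ge0//.
      by rewrite (le_trans (qM _ xI))// peakX_le1.
    rewrite (le_trans (normc_1subX _ (v1 x)))// ler_wpM2l//.
    have -> : 1 - (expi y)^* * expi x = - ((expi y)^* * (expi x - expi y)).
      by rewrite mulrBr [_ * expi y]mulrC mul_conjc normc_expi expr1n; ring.
    by rewrite normc_opp normc_mul normc_conj normc_expi mul1r.
  have s2 x : 0 <= x <= 2 * pi -> normc s.[expi x] <= peak y x ^+ M * 2.
    move=> xI; rewrite sE normc_mul ler_pM ?normc_ge0// ?qM//.
    by rewrite (le_trans (normc_sub _ _))// normc_one normc_exp v1 expr1n.
  have ps : e / 4 *+ 3 <= normc (pairing c L' s).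
    rewrite /s pairingB pairingZ.
    apply: le_trans (ler_dist_normc _ _).
    by rewrite normc_mul w1 mul1r; lra.
  pose s1 := s * peak_poly y ^+ M'.
  pose t := s * ('X^M' - peak_poly y ^+ M').
  have pt : e / 4 *+ 2 <= normc (pairing c (L' + M') t).
    have -> : t = s * 'X^M' - s1 by rewrite /t /s1 mulrBr.
    rewrite pairingB pairing_mulXn.
    apply: le_trans (ler_dist_normc _ _).
    suff : normc (pairing c (L' + M') s1) <= e / 4 by lra.
    apply: (@le_trans _ _ (C * (D%:R * (e / 4 / ((C + 1) * (D%:R + 1)))))).
      apply: pairing_le.
      move=> x xI; rewrite hornerM normc_mul normc_peak_polyX.
      apply: (@le_trans _ _ (D%:R * (normc (expi x - expi y) * peak y x ^+ M'))).
        by rewrite mulrA ler_wpM2r ?peakX_ge0// sd.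
      by rewrite ler_wpM2l.
    have -> : C * (D%:R * (e / 4 / ((C + 1) * (D%:R + 1)))) =
      e / 4 * ((C / (C + 1)) * (D%:R / (D%:R + 1))).
      by field; apply/andP; split; rewrite gt_eqF// ltr_wpDl.
    rewrite -[leRHS]mulr1 ler_wpM2l ?(ltW e4)// mulr_ile1 ?divr_ge0 ?addr_ge0//.
      by rewrite ler_pdivrMr ?ltr_wpDl// mul1r lerDl.
    by rewrite ler_pdivrMr ?ltr_wpDl// mul1r lerDl.
  have [z z1 hz] := phase_align (pairing c L p) (2^-1 * pairing c (L' + M') t).
  exists (M + M')%N, (L + (L' + M'))%N,
    (p * 'X^(L' + M') + (z * 2^-1) *: (t * 'X^L)); split; last first.
    rewrite pairingD pairingZ pairing_mulXn [(L + _)%N]addnC pairing_mulXn.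
    rewrite -mulrA hz normc_mul normc_inv.
    have -> : normc (2 : R[i]) = 2.
      by rewrite -(rmorph_nat (real_complex R) 2) normc_real ger0_norm.
    by rewrite -natr1; lra.
  move=> x xI.
  rewrite hornerD hornerZ !hornerM !hornerXn (le_trans (normc_triangle _ _))//.
  rewrite !normc_mul z1 normc_inv mul1r !normc_exp normc_expi !expr1n !mulr1.
  rewrite normc_subX_peak_polyX.
  have -> : normc (2 : R[i]) = 2.
    by rewrite -(rmorph_nat (real_complex R) 2) normc_real ger0_norm.
  rewrite exprD.
  have := pM _ xI; have := s2 _ xI; have := peakX_le1 y x M'.
  have := normc_ge0 s.[expi x].
  by nra.
have [J hJ] : exists J : nat, C < J%:R * (e / 4).
  exists (Num.Def.truncn (C / (e / 4))).+1.
  by rewrite -ltr_pdivrMr ?divr_gt0// truncnS_gt.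
have [M [L [p [pM pJ]]]] := step J.
have := @pairing_le L p 1.
rewrite mulr1 leNgt (lt_le_trans hJ pJ) => /(_ _)/negP; apply => // x xI.
by rewrite (le_trans (pM _ xI))// gerBl peakX_ge0.
Qed.

(** Compactness of the circle. If no mass is left under the kernel centred at
    [expi y], then none is left under a higher power of the kernel centred at a
    nearby point, because there such a power is concentrated where the former
    kernel is close to one. *)
Lemma no_atom_uniform (e : R) : 0 < e ->
  exists M, forall y, 0 <= y <= 2 * pi ->
    forall L p, circle_bound p (fun x => peak y x ^+ M) ->
    normc (pairing c L p) <= e.
Proof.
move=> e0.
have cpt : compact `[0 : R, 2 * pi] by exact: segment_compact.
move/compact_near_coveringP : cpt => /(_ nat \oo (fun M y =>
  forall L p, circle_bound p (fun x => peak y x ^+ M) ->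
    normc (pairing c L p) <= e)) -/(_ _ _)[].
- move=> y yI.
  have e2 : 0 < e / 2 by rewrite divr_gt0.
  have [M hM] := no_atom y e2.
  pose d := e / 2 / ((C + 1) * (M%:R + 1)).
  have d0 : 0 < d by rewrite divr_gt0// mulr_gt0// ltr_wpDl.
  have [M0 hM0] := dist_mul_peakX_small d0.
  exists ([set y' | normc (expi y' - expi y) < d], [set M' | (M0 <= M')%N]) => /=.
    by split; [exact: expi_cont|exists M0].
  case=> y' M' /= [y'd M0M'] L p hp.
  rewrite -(pairing_mulXn c L p M).
  have -> : p * 'X^M = p * peak_poly y ^+ M + p * ('X^M - peak_poly y ^+ M).
    by ring.
  rewrite pairingD (le_trans (normc_triangle _ _))// (splitr e) lerD//.
    apply: hM => x xI; rewrite hornerM normc_mul normc_peak_polyX.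
    rewrite ler_piMl ?peakX_ge0// (le_trans (hp _ xI))//.
    exact: peakX_le1.
  apply: (@le_trans _ _ (C * (M%:R * d))); last first.
    have -> : C * (M%:R * d) =
      e / 2 * ((C / (C + 1)) * (M%:R / (M%:R + 1))).
      by rewrite /d; field; apply/andP; split; rewrite gt_eqF// ltr_wpDl.
    rewrite -[leRHS]mulr1 ler_wpM2l ?(ltW e2)// mulr_ile1 ?divr_ge0 ?addr_ge0//.
      by rewrite ler_pdivrMr ?ltr_wpDl// mul1r lerDl.
    by rewrite ler_pdivrMr ?ltr_wpDl// mul1r lerDl.
  apply: pairing_le => x xI; rewrite hornerM normc_mul normc_subX_peak_polyX.
  have h1 := hp _ xI; have h2 := one_sub_peakX_le y x M.
  have h3 := hM0 _ M0M' y' x.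
  have h4 : normc (expi x - expi y) <=
      normc (expi x - expi y') + normc (expi y' - expi y).
    apply: le_trans (normc_triangle _ _).
    by rewrite addrA subrK.
  have h5 := dist_expi_le2 x y; have h6 := normc_ge0 (expi x - expi y).
  have h7 := peakX_ge0 y' x M'; have h8 := peakX_le1 y' x M'.
  have h9 := normc_ge0 (expi x - expi y').
  have h10 := peakX_le1 y x M.
  apply: (@le_trans _ _ (peak y' x ^+ M' *
      (M%:R * (normc (expi x - expi y) ^+ 2 / 4)))).
    by apply: ler_pM => //; rewrite ?normc_ge0// subr_ge0.
  rewrite mulrCA ler_wpM2l//.
  apply: (@le_trans _ _ (peak y' x ^+ M' * (normc (expi x - expi y) / 2))).
    by rewrite ler_wpM2l//; nra.
  have k1 := ler_wpM2l h7 h4; rewrite mulrDr in k1.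
  have k2 : peak y' x ^+ M' * normc (expi y' - expi y) <= d.
    by rewrite (le_trans _ (ltW y'd))// ler_piMl// normc_ge0.
  by lra.
- move=> M _ hM; exists M => y yI L p hp.
  by apply: (hM M _ y); rewrite ?inE//= ?in_itv//; exact: leqnn.
Qed.

(** Divided by [N], the sum on the left is the value of the functional at the
    normalized Dirichlet kernel, which is at most one and is of size [1 / N] away
    from [expi y], so that only the mass close to that point matters. *)
Lemma mean_small_uniform (e : R) : 0 < e -> exists K, forall N y,
  0 <= y <= 2 * pi ->
  normc (\sum_(n < N) c (- n%:Z) * expi y ^+ n) <= N%:R * e + K.
Proof.
move=> e0; have [M hM] := no_atom_uniform e0.
exists (C * M%:R) => -[|N] y yI.
  by rewrite big_ord0 normc_zero mul0r add0r mulr_ge0.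
pose p : {poly R[i]} := \poly_(i < N.+1) (expi y ^+ (N - i)).
have pE : \sum_(n < N.+1) c (- n%:Z) * expi y ^+ n = pairing c N p.
  rewrite (pairing_widen _ _ (size_poly _ _)) (reindex_inj rev_ord_inj) /=.
  apply: eq_bigr => i _; rewrite subSS mulrC coef_poly ltn_ord.
  congr (_ * c _); have iN : (i <= N)%N by rewrite -ltnS.
  by rewrite -subzn// opprB.
have pu x : p.[expi x] = \sum_(i < N.+1) expi x ^+ i * expi y ^+ (N - i).
  by rewrite horner_poly; apply: eq_bigr => i _; rewrite mulrC.
have p1 x : normc p.[expi x] <= N.+1%:R.
  rewrite pu -[leRHS]mulr1.
  apply: (@normc_le_sum_const _ N.+1
    (fun i => expi x ^+ i * expi y ^+ (N - i))) => i _.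
  by rewrite normc_mul !normc_exp !normc_expi !expr1n mulr1.
have p2 x : normc (expi x - expi y) * normc p.[expi x] <= 2.
  rewrite -normc_mul pu.
  have -> : (expi x - expi y) *
      \sum_(i < N.+1) expi x ^+ i * expi y ^+ (N - i) =
      expi x ^+ N.+1 - expi y ^+ N.+1.
    rewrite -[RHS]opprB subrXX -mulNr opprB; congr (_ * _).
    by apply: eq_bigr => i _; rewrite mulrC.
  by rewrite (le_trans (normc_sub _ _))// !normc_exp !normc_expi !expr1n.
rewrite pE -(pairing_mulXn c N p M).
have -> : p * 'X^M = p * peak_poly y ^+ M + p * ('X^M - peak_poly y ^+ M).
  by ring.
rewrite pairingD (le_trans (normc_triangle _ _))// lerD//.
  have -> : p * peak_poly y ^+ M =
      N.+1%:R%:C *: ((N.+1%:R^-1)%:C *: p * peak_poly y ^+ M).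
    have n0 : N.+1%:R != 0 :> R by rewrite pnatr_eq0.
    by rewrite -scalerAl scalerA -rmorphM mulfV// rmorph1 scale1r.
  rewrite pairingZ normc_mul normc_real ger0_norm// ler_wpM2l//.
  apply: (hM y yI) => x xI; rewrite hornerM hornerZ !normc_mul normc_peak_polyX.
  rewrite ler_piMl ?peakX_ge0// normc_real ger0_norm ?invr_ge0//.
  by rewrite mulrC ler_pdivrMr ?ltr0n// mul1r.
apply: pairing_le => x xI; rewrite hornerM normc_mul normc_subX_peak_polyX.
have h2 := one_sub_peakX_le y x M.
have h5 := dist_expi_le2 x y; have h6 := normc_ge0 (expi x - expi y).
apply: (@le_trans _ _ (normc p.[expi x] *
    (M%:R * (normc (expi x - expi y) ^+ 2 / 4)))).
  by rewrite ler_wpM2l// normc_ge0.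
rewrite mulrCA -[leRHS]mulr1 ler_wpM2l//.
have := p2 x; have := normc_ge0 p.[expi x].
by nra.
Qed.

(** The mean square is itself a value of the functional, at the Cesaro mean of
    the conjugate coefficients, and that polynomial is uniformly small since the
    functional has no atoms. *)
Lemma wiener (e : R) : 0 < e -> exists N0, forall N, (N0 <= N)%N ->
  \sum_(n < N) normc (c (- n%:Z)) ^+ 2 <= N%:R * e.
Proof.
move=> e0.
have d0 : 0 < e / 2 / (C + 1) by rewrite !divr_gt0// ltr_wpDl.
have [K hK] := mean_small_uniform d0.
have K0 : 0 <= K.
  have := hK 0%N 0; rewrite big_ord0 normc_zero mul0r add0r; apply.
  by rewrite lexx/= mulr_ge0// pi_ge0.
exists (Num.Def.truncn (C * K / (e / 2))).+1 => -[//|N] hN.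
pose p : {poly R[i]} := \poly_(i < N.+1) (c (- (N - i)%N%:Z))^*.
have pE : pairing c N p =
    (\sum_(n < N.+1) normc (c (- n%:Z)) ^+ 2)%:C.
  rewrite (pairing_widen _ _ (size_poly _ _)) [in RHS](reindex_inj rev_ord_inj) /=.
  rewrite rmorph_sum; apply: eq_bigr => i _.
  rewrite subSS /= -mul_conjc mulrC coef_poly ltn_ord.
  congr (c _ * _); have iN : (i <= N)%N by rewrite -ltnS.
  by rewrite -subzn// opprB.
have := @pairing_le N p (N.+1%:R * (e / 2 / (C + 1)) + K).
rewrite pE normc_real ger0_norm; last first.
  by apply: sumr_ge0 => i _; rewrite sqr_ge0.
move=> /(_ _)/le_trans; apply.
  move=> x xI; rewrite -(normc_conj p.[_]).
  have -> : p.[expi x]^* =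
    (expi x)^* ^+ N * \sum_(n < N.+1) c (- n%:Z) * expi x ^+ n.
    rewrite horner_poly rmorph_sum mulr_sumr [RHS](reindex_inj rev_ord_inj) /=.
    apply: eq_bigr => i _; rewrite rmorphM rmorphXn /= conjcK subSS.
    rewrite mulrCA; congr (_ * _); have iN : (i <= N)%N by rewrite -ltnS.
    rewrite -{2}(subnK iN) addnC exprD -mulrA -exprMn [_^* * _]mulrC.
    by rewrite mul_conjc normc_expi !expr1n mulr1.
  by rewrite normc_mul normc_exp normc_conj normc_expi expr1n mul1r hK.
have : C * K / (e / 2) <= N.+1%:R.
  by rewrite (le_trans (ltW (truncnS_gt _)))// ler_nat.
rewrite ler_pdivrMr ?divr_gt0// => h.
have -> : N.+1%:R * e = N.+1%:R * (e / 2) + N.+1%:R * (e / 2) by lra.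
rewrite mulrDr lerD// mulrCA ler_wpM2l//.
have e2 : 0 <= e / 2 by rewrite divr_ge0// ltW.
rewrite mulrCA -[leRHS]mulr1 ler_wpM2l//.
by rewrite ler_pdivrMr ?ltr_wpDl// mul1r lerDl.
Qed.

End wiener.

(** * Polynomials with constant term one that are small off an arc *)

Section arc_distance.
Context {R : realType}.
Implicit Types x y h : R.

Lemma cos_le_off_arc h y : 0 < h -> h <= `|y| -> `|y| <= 2 * pi - h ->
  cos y <= cos h.
Proof.
move=> h0 hy yh.
rewrite -(cos_norm y).
have p0 := pi_gt0 R.
have [yp|yp] := leP `|y| pi.
  rewrite leNgt ltr_cos ?in_itv/= ?normr_ge0// -?leNgt//.
  by apply/andP; split; lra.
have -> : cos `|y| = cos (2 * pi - `|y|).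
  rewrite -[LHS]cosN -(@cosD2pi R (- `|y|)) addrC; congr (cos (_ + _)).
  by rewrite mulr_natl.
rewrite leNgt ltr_cos ?in_itv/= -?leNgt; first lra.
- by apply/andP; split; lra.
- by apply/andP; split; lra.
Qed.

Lemma dist_expi_off_arc (s t : R) : 0 <= s -> s < t -> t <= 2 * pi ->
  exists2 d : R, 0 < d & forall x, 0 <= x <= 2 * pi -> x \notin `]s, t[ ->
    d <= normc (expi x - expi ((s + t) / 2)) ^+ 2.
Proof.
move=> s0 st t2; pose h := (t - s) / 2.
have h0 : 0 < h by rewrite divr_gt0// subr_gt0.
have p0 := pi_gt0 R.
have hp : h <= pi by rewrite /h; lra.
exists (2 - 2 * cos h).
  suff : cos h < cos 0 by rewrite cos0; lra.
  rewrite ltr_cos ?in_itv/= ?lexx ?(ltW p0)//.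
  by rewrite hp (ltW h0).
move=> x /andP[x0 x2]; rewrite in_itv /= negb_and -!leNgt => xst.
set y := (s + t) / 2.
have -> : normc (expi x - expi y) ^+ 2 = 2 - 2 * cos (x - y).
  rewrite sqr_normc_ReIm /= cosB.
  have := cos2Dsin2 x; have := cos2Dsin2 y.
  by move=> h1 h2; nra.
rewrite lerD2l lerN2 ler_pM2l// cos_le_off_arc//.
  by rewrite ler_normr /h /y; case/orP: xst => ?; apply/orP; [right|left]; lra.
by rewrite ler_norml /h /y; apply/andP; split; case/orP: xst => ?; lra.
Qed.

End arc_distance.

Section small_polynomial.
Context {R : realType}.
Implicit Types (w : R[i]) (N m : nat).

(** Passing from [N] to [N.+1] adds to the left side twice the real part of a
    geometric sum, which on the circle is what the cross terms of the square on
    the right side amount to. *)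
Lemma fejer_identity w N : normc w = 1 ->
  2 * complex.Re (\sum_(j < N) (N - j)%:R * w ^+ j) =
  normc (\sum_(j < N) w ^+ j) ^+ 2 + N%:R.
Proof.
move=> w1; elim: N => [|N IH].
  by rewrite !big_ord0 normc_zero expr0n /= mulr0 addr0.
have -> : \sum_(j < N.+1) (N.+1 - j)%:R * w ^+ j =
    \sum_(j < N) (N - j)%:R * w ^+ j + \sum_(j < N.+1) w ^+ j.
  rewrite [in RHS]big_ord_recr addrA -big_split big_ord_recr /= subSnn mul1r.
  congr (_ + _); apply: eq_bigr => i _.
  by rewrite subSn 1?ltnW// -natr1 mulrDl mul1r.
rewrite complex_ReD mulrDr IH.
have hr : complex.Re (\sum_(j < N.+1) w ^+ j) =
    1 + complex.Re ((\sum_(j < N) w ^+ j)^* * w ^+ N).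
  rewrite big_ord_recl complex_ReD /=; congr (_ + complex.Re _).
  rewrite rmorph_sum mulr_suml (reindex_inj rev_ord_inj) /=.
  apply: eq_bigr => i _; rewrite rmorphXn /= /bump /= add1n subnSK//.
  have iN : (i <= N)%N by rewrite ltnW.
  have -> : w ^+ N = w ^+ i * w ^+ (N - i) by rewrite -exprD subnKC.
  rewrite mulrA -exprMn [_^* * _]mulrC mul_conjc w1.
  by rewrite !expr1n mul1r.
rewrite hr big_ord_recr /=.
set S := \sum_(i < N) w ^+ i; set v := w ^+ N.
have : normc v ^+ 2 = 1 by rewrite normc_exp w1 !expr1n.
rewrite !sqr_normc_ReIm -natr1; case: S v => [a b] [a' b'] /= h.
by nra.
Qed.

(** By Fejer's identity there is a polynomial [h] without constant term whose
    real part, the Fejer kernel minus its mean, is at most [- 1 / 2] off the arc.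
    For small [eta] the polynomial [1 + eta h] is a contraction there, and it
    keeps the value one at the origin; its powers do the rest. *)
Lemma small_poly_off_arc (s t e : R) : 0 <= s -> s < t -> t <= 2 * pi -> 0 < e ->
  exists2 p : {poly R[i]}, p`_0 = 1 &
    forall x, 0 <= x <= 2 * pi -> x \notin `]s, t[ -> normc p.[expi x] <= e.
Proof.
move=> s0 st t2 e0.
have [d d0 hd] := dist_expi_off_arc s0 st t2.
set y := (s + t) / 2 in hd.
(* Off the arc the Fejer kernel of order [N] is at most [4 / (N * d)]. *)
pose N := (Num.Def.truncn (8 / d)).+1.
have N8 : 8 <= N%:R * d.
  by rewrite -ler_pdivrMr// ltW// truncnS_gt.
have N0 : (0 : R) < N%:R by rewrite ltr0n.
(* If [Re h <= - 1 / 2] and [|h| <= B], then [|1 + eta h|^2] is at most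
   [1 - eta + eta^2 B^2], which is [q] for this [eta]. *)
pose B : R := 2 * N%:R + 2.
pose eta : R := (2 * B ^+ 2)^-1.
have B0 : 0 < B by rewrite /B; lra.
have eta0 : 0 < eta by rewrite invr_gt0 mulr_gt0// exprn_gt0.
pose c := (expi y)^*.
pose H : {poly R[i]} := \poly_(j < N) ((N - j)%:R * c ^+ j).
pose g : {poly R[i]} := 1 + eta%:C *: ((2 / N%:R)%:C *: H - 2%:P).
pose q : R := 1 - (4 * B ^+ 2)^-1.
have B2 : 4 <= B ^+ 2.
  by have hb : 2 <= B; [rewrite /B; lra|nra].
have q0 : 0 <= q.
  rewrite subr_ge0 invf_le1 ?mulr_gt0 ?exprn_gt0//; lra.
have q1 : `|q| < 1.
  by rewrite ger0_norm// gtrBl invr_gt0 mulr_gt0// exprn_gt0.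
have g0 : g.[0] = 1.
  rewrite hornerD hornerZ hornerD hornerN hornerZ !hornerC horner_coef0.
  rewrite coef_poly /= subn0 expr0 mulr1.
  suff -> : (2 / N%:R)%:C * N%:R = 2 :> R[i] by rewrite subrr mulr0 addr0.
  rewrite rmorphM fmorphV !rmorph_nat mulfVK//.
  by rewrite pnatr_eq0.
have gx x : 0 <= x <= 2 * pi -> x \notin `]s, t[ -> normc g.[expi x] ^+ 2 <= q.
  move=> xI xst; pose w := c * expi x.
  have w1 : normc w = 1 by rewrite /w normc_mul normc_conj !normc_expi mul1r.
  pose hw := (2 / N%:R)%:C * (\sum_(j < N) (N - j)%:R * w ^+ j) - 2.
  have -> : g.[expi x] = 1 + eta%:C * hw.
    rewrite hornerD hornerZ hornerD hornerN hornerZ !hornerC horner_poly.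
    suff -> : \sum_(j < N) (N - j)%:R * c ^+ j * expi x ^+ j =
      \sum_(j < N) (N - j)%:R * w ^+ j by [].
    by apply: eq_bigr => j _; rewrite exprMn mulrA.
  have reh : complex.Re hw <= - (1 / 2).
    pose S := \sum_(j < N) w ^+ j.
    have -> : complex.Re hw = normc S ^+ 2 / N%:R - 1.
      have F := fejer_identity N w1; rewrite -/S in F.
      have -> : complex.Re hw = (2 / N%:R) *
          complex.Re (\sum_(j < N) (N - j)%:R * w ^+ j) - 2.
        by rewrite /hw; case: (\sum_(j < N) _) => a b /=; ring.
      have -> : complex.Re (\sum_(j < N) (N - j)%:R * w ^+ j) =
        (normc S ^+ 2 + N%:R) / 2 by rewrite -F; field.
      by field; rewrite gt_eqF.
    have hS : normc S ^+ 2 * d <= 4.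
      apply: (@le_trans _ _ (normc S ^+ 2 * normc (1 - w) ^+ 2)).
        rewrite ler_wpM2l ?sqr_ge0//.
        have -> : 1 - w = c * (expi y - expi x).
          by rewrite mulrBr {1}/c [_ * expi y]mulrC mul_conjc normc_expi expr1n.
        by rewrite normc_mul normc_conj normc_expi mul1r normc_distC hd.
      have -> : normc S ^+ 2 * normc (1 - w) ^+ 2 = normc (1 - w ^+ N) ^+ 2.
        rewrite -exprMn -normc_mul mulrC; congr (normc _ ^+ 2).
        rewrite -{2}(expr1n _ N) subrXX; congr (_ * _).
        by apply: eq_bigr => i _; rewrite expr1n mul1r.
      have := normc_sub 1 (w ^+ N); rewrite normc_one normc_exp w1 expr1n.
      by have := normc_ge0 (1 - w ^+ N); nra.
    suff : normc S ^+ 2 / N%:R <= 1 / 2 by lra.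
    rewrite ler_pdivrMr//.
    have := sqr_ge0 (normc S) => S0.
    suff : normc S ^+ 2 * d * 2 <= N%:R * d by nra.
    by lra.
  have hB : normc hw <= B.
    have -> : B = (2 / N%:R) * (N%:R * N%:R) + 2.
      by rewrite /B; field; rewrite gt_eqF.
    rewrite (le_trans (normc_sub _ _))// lerD//; last first.
      by rewrite -(rmorph_nat (real_complex R) 2) normc_real ger0_norm.
    rewrite normc_mul normc_real ger0_norm ?divr_ge0// ler_wpM2l ?divr_ge0//.
    apply: (@normc_le_sum_const _ N (fun j => (N - j)%:R * w ^+ j)) => j jN.
    rewrite normc_mul normc_exp w1 expr1n mulr1.
    by rewrite -(rmorph_nat (real_complex R)) normc_real ger0_norm// ler_nat leq_subr.
  have -> : normc (1 + eta%:C * hw) ^+ 2 =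
      1 + 2 * eta * complex.Re hw + eta ^+ 2 * normc hw ^+ 2.
    by rewrite !sqr_normc_ReIm; case: (hw) => a b /=; ring.
  have hB2 : normc hw ^+ 2 <= B ^+ 2.
    by rewrite ler_sqr ?nnegrE ?normc_ge0// ltW.
  have k1 : eta ^+ 2 * normc hw ^+ 2 <= eta ^+ 2 * B ^+ 2.
    by rewrite ler_wpM2l// sqr_ge0.
  have k2 : eta ^+ 2 * B ^+ 2 = eta / 2.
    by rewrite /eta; field; rewrite gt_eqF.
  have k3 : (4 * B ^+ 2)^-1 = eta / 2 by rewrite /eta; field; rewrite gt_eqF.
  rewrite /q k3.
  by nra.
have e2 : 0 < e ^+ 2 by rewrite exprn_gt0.
have /cvgrPdist_le/(_ _ e2)[m _ /(_ m (leqnn m)) hm] := cvg_expr q1.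
exists (g ^+ m).
  by rewrite -horner_coef0 horner_exp g0 expr1n.
move=> x xI xst; rewrite -ler_sqr ?nnegrE ?normc_ge0 ?(ltW e0)//.
rewrite horner_exp normc_exp -exprM mulnC exprM.
apply: (@le_trans _ _ (q ^+ m)).
  by rewrite lerXn2r ?nnegrE ?sqr_ge0// gx.
by move: hm; rewrite /= sub0r normrN ger0_norm// exprn_ge0.
Qed.

End small_polynomial.

(** * Power series with bounded coefficients *)

Section complex_limits.
Context {R : realType}.
Implicit Types (u v : nat -> R[i]) (l : R[i]).

(** The tolerance is a real number, whereas the topology of [R[i]^o] has its
    radii in [R[i]]. *)
Definition tends u l := forall e : R, 0 < e ->
  exists n0, forall n, (n0 <= n)%N -> normc (u n - l) <= e.

Lemma normE (z : R[i]^o) : `|z| = (normc z)%:C.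
Proof. by []. Qed.

Lemma realC_gt0 (e : R[i]) : 0 < e -> exists2 e' : R, 0 < e' & e = e'%:C.
Proof.
case: e => a b; rewrite ltcE /= => /andP[/eqP -> a0].
by exists a.
Qed.

Lemma tends_cvg u l : tends u l -> (u : nat -> R[i]^o) @ \oo --> (l : R[i]^o).
Proof.
move=> ul; apply/cvgrPdist_lt => e /realC_gt0[e' e'0 ->].
have e2 : 0 < e' / 2 by rewrite divr_gt0.
have [n0 hn0] := ul _ e2; exists n0 => // n /= n0n.
rewrite normE ltcR normc_distC (le_lt_trans (hn0 _ n0n))//.
by rewrite ltr_pdivrMr// ltr_pMr// ltr1n.
Qed.

Lemma tends_limn u l : tends u l -> limn (u : nat -> R[i]^o) = l.
Proof. by move/tends_cvg; exact: cvg_lim. Qed.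

Lemma tends_unique u l l' : tends u l -> tends u l' -> l = l'.
Proof. by move=> /tends_limn <- /tends_limn <-. Qed.

Lemma tends_normc_le u l (B : R) : tends u l -> (forall n, normc (u n) <= B) ->
  normc l <= B.
Proof.
move=> ul uB; apply/ler_addgt0Pl => e e0; have [n0 /(_ _ (leqnn n0)) h] := ul _ e0.
rewrite -(subrK (u n0) l) (le_trans (normc_triangle _ _))// lerD//.
by rewrite normc_distC.
Qed.

Lemma tends_ReIm u (x y : R) :
  (fun n => complex.Re (u n)) @ \oo --> x ->
  (fun n => complex.Im (u n)) @ \oo --> y ->
  tends u (x +i* y).
Proof.
move=> /cvgrPdist_le hx /cvgrPdist_le hy e e0.
have e2 : 0 < e / 2 by rewrite divr_gt0.
have [n1 _ h1] := hx _ e2; have [n2 _ h2] := hy _ e2.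
exists (maxn n1 n2) => n; rewrite geq_max => /andP[n1n n2n].
have {}h1 := h1 _ n1n; have {}h2 := h2 _ n2n.
rewrite (le_trans (normc_le_ReIm _))// (splitr e) lerD//.
  by move: h1; rewrite /= distrC; case: (u n).
by move: h2; rewrite /= distrC; case: (u n).
Qed.

Lemma Re_sum (I : Type) (r : seq I) (Q : pred I) (F : I -> R[i]) :
  complex.Re (\sum_(i <- r | Q i) F i) = \sum_(i <- r | Q i) complex.Re (F i).
Proof. by elim/big_rec2 : _ => [//|i x y _ <-]; case: (F i); case: y. Qed.

Lemma Im_sum (I : Type) (r : seq I) (Q : pred I) (F : I -> R[i]) :
  complex.Im (\sum_(i <- r | Q i) F i) = \sum_(i <- r | Q i) complex.Im (F i).
Proof. by elim/big_rec2 : _ => [//|i x y _ <-]; case: (F i); case: y. Qed.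

Lemma abs_summable_tends u (B : R) :
  (forall n, \sum_(k < n) normc (u k) <= B) ->
  exists l, tends (fun n => \sum_(k < n) u k) l.
Proof.
move=> uB.
have h0 : cvgn (series (fun n => normc (u n))).
  apply: nondecreasing_is_cvgn.
    by apply/nondecreasing_seqP => n; rewrite seriesSr lerDl normc_ge0.
  by exists B => _ [n _ <-]; rewrite /series /= big_mkord.
have hR : cvgn (series (fun n => complex.Re (u n))).
  apply: normed_cvg; apply: (series_le_cvg _ _ _ h0) => n //=.
  - exact: normc_ge0.
  - exact: abs_Re_le.
have hI : cvgn (series (fun n => complex.Im (u n))).
  apply: normed_cvg; apply: (series_le_cvg _ _ _ h0) => n //=.
  - exact: normc_ge0.
  - exact: abs_Im_le.
exists (limn (series (fun n => complex.Re (u n))) +i*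
        limn (series (fun n => complex.Im (u n)))).
apply: tends_ReIm.
  suff <- : series (fun n => complex.Re (u n)) =
    (fun n => complex.Re (\sum_(k < n) u k)) by [].
  by apply/funext => n; rewrite /= Re_sum /series /= big_mkord.
suff <- : series (fun n => complex.Im (u n)) =
  (fun n => complex.Im (\sum_(k < n) u k)) by [].
by apply/funext => n; rewrite /= Im_sum /series /= big_mkord.
Qed.

End complex_limits.

Section bounded_power_series.
Context {R : realType}.
Variable M : R.
Implicit Types (c : nat -> R[i]) (z w : R[i]).

Definition bounded_coefs c := forall n, normc (c n) <= M.

Lemma geometric_sum_le (r : R) n : 0 <= r < 1 ->
  \sum_(k < n) r ^+ k <= (1 - r)^-1.
Proof.
move=> /andP[r0 r1]; have r1' : 0 < 1 - r by rewrite subr_gt0.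
rewrite -[leRHS]mul1r ler_pdivlMr// mulrC.
have -> : (1 - r) * \sum_(k < n) r ^+ k = 1 - r ^+ n.
  rewrite -{2}(expr1n _ n) subrXX; congr (_ * _); apply: eq_bigr => i _.
  by rewrite expr1n mul1r.
by rewrite gerBl exprn_ge0.
Qed.

Lemma power_sum_le c z n : bounded_coefs c -> normc z < 1 ->
  \sum_(k < n) normc (c k * z ^+ k) <= M / (1 - normc z).
Proof.
move=> cM z1; have M0 : 0 <= M by rewrite (le_trans _ (cM 0%N))// normc_ge0.
apply: (@le_trans _ _ (M * \sum_(k < n) normc z ^+ k)).
  rewrite mulr_sumr; apply: ler_sum => k _.
  by rewrite normc_mul normc_exp ler_wpM2r// exprn_ge0// normc_ge0.
by rewrite ler_wpM2l// geometric_sum_le// normc_ge0.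
Qed.

Lemma power_series_tends c z : bounded_coefs c -> normc z < 1 ->
  tends (fun n => \sum_(k < n) c k * z ^+ k) (power_series c z).
Proof.
move=> cM z1.
have [l hl] := @abs_summable_tends R (fun k => c k * z ^+ k) _
  (fun n => power_sum_le n cM z1).
suff -> : power_series c z = l by [].
apply: (@tends_limn R (series (fun n => c n * z ^+ n : R[i]^o)) l).
suff -> : series (fun n => c n * z ^+ n : R[i]^o) =
  (fun n => \sum_(k < n) c k * z ^+ k) by [].
by apply/funext => n; rewrite /series /= big_mkord.
Qed.

Lemma normc_power_series_le c z : bounded_coefs c -> normc z < 1 ->
  normc (power_series c z) <= M / (1 - normc z).
Proof.
move=> cM z1; apply: (tends_normc_le (power_series_tends cM z1)) => n.
exact: le_trans (normc_sum _ _ _) (power_sum_le n cM z1).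
Qed.

Definition shift_coefs c m : nat -> R[i] := fun n => c (n + m)%N.

Lemma shift_bounded c m : bounded_coefs c -> bounded_coefs (shift_coefs c m).
Proof. by move=> cM n; exact: cM. Qed.

Lemma power_series_split c z m : bounded_coefs c -> normc z < 1 ->
  power_series c z = \sum_(k < m) c k * z ^+ k +
                     z ^+ m * power_series (shift_coefs c m) z.
Proof.
move=> cM z1; apply: tends_unique (power_series_tends cM z1) _ => e e0.
have [n0 hn0] := power_series_tends (shift_bounded m cM) z1 e0.
exists (m + n0)%N => n mn.
have -> : n = (m + (n - m))%N by rewrite subnKC// (leq_trans _ mn)// leq_addr.
rewrite big_split_ord /= opprD addrACA subrr add0r.
have -> : \sum_(i < n - m) c (m + i)%N * z ^+ (m + i) =
          z ^+ m * \sum_(i < n - m) shift_coefs c m i * z ^+ i.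
  rewrite mulr_sumr; apply: eq_bigr => i _.
  by rewrite /shift_coefs addnC exprD; ring.
rewrite -mulrBr normc_mul normc_exp (le_trans _ (hn0 (n - m)%N _))//; last first.
  by rewrite leq_subRL// (leq_trans _ mn)// leq_addr.
by rewrite ler_piMl ?normc_ge0// exprn_ile1 ?normc_ge0// ltW.
Qed.

Lemma power_series_tail c z m : bounded_coefs c -> normc z < 1 ->
  normc (power_series c z - \sum_(k < m) c k * z ^+ k) <=
  normc z ^+ m * (M / (1 - normc z)).
Proof.
move=> cM z1; rewrite (power_series_split m cM z1) addrAC subrr add0r.
rewrite normc_mul normc_exp ler_wpM2l ?exprn_ge0 ?normc_ge0//.
exact: normc_power_series_le (shift_bounded m cM) z1.
Qed.

(** The difference quotient at [z] is again a power series with bounded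
    coefficients, namely the values at [z] of the successive tails. *)
Definition quotient_coefs c z : nat -> R[i] :=
  fun m => power_series (shift_coefs c m.+1) z.

Lemma quotient_coefs_le c z n : bounded_coefs c -> normc z < 1 ->
  normc (quotient_coefs c z n) <= M / (1 - normc z).
Proof. by move=> cM z1; exact/normc_power_series_le/z1/shift_bounded. Qed.

Lemma power_sum_quotient c z w n : bounded_coefs c -> normc z < 1 ->
  \sum_(k < n.+1) c k * w ^+ k = power_series c z +
    (w - z) * (\sum_(k < n) quotient_coefs c z k * w ^+ k) -
    z * quotient_coefs c z n * w ^+ n.
Proof.
move=> cM z1.
have q0 : power_series c z = c 0%N + z * quotient_coefs c z 0.
  by rewrite (power_series_split 1 cM z1) big_ord1 !expr0 mulr1 expr1.
have qS m : quotient_coefs c z m = c m.+1 + z * quotient_coefs c z m.+1.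
  rewrite {1}/quotient_coefs (power_series_split 1 (shift_bounded _ cM) z1).
  rewrite big_ord1 expr0 mulr1 expr1 {1}/shift_coefs add0n /quotient_coefs.
  suff -> : shift_coefs (shift_coefs c m.+1) 1 = shift_coefs c m.+2 by [].
  by apply/funext => k; rewrite /shift_coefs addn1 addSnnS.
elim: n => [|n IH].
  by rewrite big_ord0 big_ord1 !expr0 q0; ring.
rewrite big_ord_recr IH [in RHS]big_ord_recr /= (qS n) exprS.
by ring.
Qed.

End bounded_power_series.

Section analyticity.
Context {R : realType}.
Implicit Types (c : nat -> R[i]) (z w : R[i]) (M : R).

Lemma power_series_sub M c z w : bounded_coefs M c ->
  normc z < 1 -> normc w < 1 ->
  power_series c w - power_series c z =
  (w - z) * power_series (quotient_coefs c z) w.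
Proof.
move=> cM z1 w1.
have bM : bounded_coefs (M / (1 - normc z)) (quotient_coefs c z).
  by move=> n; exact: quotient_coefs_le.
have M0 : 0 <= M / (1 - normc z) by rewrite (le_trans _ (bM 0%N))// normc_ge0.
apply/eqP; rewrite subr_eq addrC; apply/eqP.
apply: tends_unique (power_series_tends cM w1) _ => e e0.
have e3 : 0 < e / 3 by rewrite divr_gt0.
have [n0 hn0] := power_series_tends bM w1 e3.
have w1' : `|normc w| < 1 by rewrite ger0_norm// normc_ge0.
have d0 : 0 < e / 3 / (M / (1 - normc z) + 1) by rewrite divr_gt0// ltr_wpDl.
have /cvgrPdist_le/(_ _ d0)[n1 _ hn1] := cvg_expr w1'.
exists (maxn n0 n1).+1 => -[//|n]; rewrite ltnS geq_max => /andP[n0n n1n].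
rewrite (power_sum_quotient _ _ cM z1).
have -> : forall a x y s : R[i], a + (w - z) * x - y - (a + (w - z) * s) =
  w * (x - s) - z * (x - s) - y by move=> *; ring.
rewrite (le_trans (normc_sub _ _))//.
apply: (@le_trans _ _ (e / 3 + e / 3 + e / 3)); last by lra.
have hb : forall v : R[i], normc v < 1 -> normc (v * (\sum_(k < n) quotient_coefs c z k * w ^+ k -
    power_series (quotient_coefs c z) w)) <= e / 3.
  move=> v v1; rewrite normc_mul -[leRHS]mul1r ler_pM ?normc_ge0 ?(ltW v1)//.
  exact: hn0.
rewrite lerD//.
  by rewrite (le_trans (normc_sub _ _))// lerD// hb.
rewrite !normc_mul normc_exp.
have := hn1 _ n1n; rewrite /= sub0r normrN ger0_norm ?exprn_ge0 ?normc_ge0//.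
rewrite ler_pdivlMr ?ltr_wpDl// => h.
apply: le_trans h; rewrite mulrC ler_wpM2l ?exprn_ge0 ?normc_ge0//.
rewrite -[leLHS]mulrC (le_trans (y := M / (1 - normc z) * 1))//.
  by rewrite ler_pM ?normc_ge0 ?bM// ltW.
by rewrite mulr1 lerDl.
Qed.

Lemma power_series_lipschitz M c z w : bounded_coefs M c ->
  normc z < 1 -> normc w < 1 ->
  normc (power_series c w - power_series c z) <=
  normc (w - z) * (M / (1 - normc z) / (1 - normc w)).
Proof.
move=> cM z1 w1; rewrite (power_series_sub cM z1 w1) normc_mul.
rewrite ler_wpM2l ?normc_ge0//; apply: normc_power_series_le => // n.
exact: quotient_coefs_le.
Qed.

Lemma power_series_analytic M c : bounded_coefs M c ->
  analytic_on_disk (power_series c).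
Proof.
move=> cM z; rewrite normE ltcR => z1.
have bM : bounded_coefs (M / (1 - normc z)) (quotient_coefs c z).
  by move=> n; exact: quotient_coefs_le.
have M0 : 0 <= M / (1 - normc z) by rewrite (le_trans _ (bM 0%N))// normc_ge0.
move: (M / (1 - normc z)) bM M0 => K bM K0.
set B := K / (1 - normc z) / ((1 - normc z) / 2).
have d1 : 0 < 1 - normc z by rewrite subr_gt0.
have d0 := ltW d1; have B0 : 0 <= B by rewrite !divr_ge0.
apply/cvg_ex; exists (power_series (quotient_coefs c z) z : R[i]^o).
apply/cvgrPdist_lt => e /realC_gt0[e' e'0 ->].
have dd : 0 < Num.min ((1 - normc z) / 2) (e' / (B + 1)).
  by rewrite lt_min !divr_gt0// ltr_wpDl.
have dC : 0 < (Num.min ((1 - normc z) / 2) (e' / (B + 1)))%:C by rewrite ltcR.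
exists (Num.min ((1 - normc z) / 2) (e' / (B + 1)))%:C => //= h.

rewrite /ball_ /= sub0r normrN normE ltcR lt_min => /andP[h1 h2] h0.
have w1' : normc (h + z) <= 1 - (1 - normc z) / 2.
  by rewrite (le_trans (normc_triangle _ _))//; lra.
have w1 : normc (h + z) < 1 by rewrite (le_lt_trans w1')// gtrBl divr_gt0.
have -> : h *: (1 : R[i]^o) + z = h + z by rewrite [h *: _]mulr1.
rewrite (power_series_sub cM z1 w1) addrK.
have -> : forall x : R[i]^o, h^-1 *: (h * x) = x.
  by move=> x; rewrite -[LHS]/(h^-1 * (h * x)) mulKf.
rewrite normE ltcR normc_distC.
rewrite (le_lt_trans (power_series_lipschitz bM z1 w1))// addrK.
apply: (@le_lt_trans _ _ (normc h * B)).
  rewrite ler_wpM2l ?normc_ge0// /B ler_wpM2l ?divr_ge0//.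
  rewrite lef_pV2 ?posrE ?divr_gt0// ?subr_gt0//.
  by lra.
move: h2; rewrite ltr_pdivlMr ?ltr_wpDl// mulrDr mulr1.
by apply: le_lt_trans; rewrite lerDl normc_ge0.
Qed.

End analyticity.

(** * Integrals of complex functions over one period *)

Section complex_integral.
Context {R : realType}.
Implicit Types (f g : R -> R[i]) (h k : R -> R).

Lemma continuous_addf h k : continuous h -> continuous k ->
  continuous (fun x => h x + k x).
Proof. by move=> hc kc x; apply: cvgD; [exact: hc|exact: kc]. Qed.

Lemma continuous_subf h k : continuous h -> continuous k ->
  continuous (fun x => h x - k x).
Proof. by move=> hc kc x; apply: cvgB; [exact: hc|exact: kc]. Qed.

Lemma continuous_oppf h : continuous h -> continuous (fun x => - h x).
Proof. by move=> hc x; apply: cvgN; exact: hc. Qed.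

Lemma continuous_mulf h k : continuous h -> continuous k ->
  continuous (fun x => h x * k x).
Proof. by move=> hc kc x; apply: cvgM; [exact: hc|exact: kc]. Qed.

Definition ccontinuous f :=
  continuous (fun x => complex.Re (f x)) /\
  continuous (fun x => complex.Im (f x)).

Lemma ccontinuous_cst (z : R[i]) : ccontinuous (fun=> z).
Proof. by split => x; exact: cvg_cst. Qed.

Lemma ccontinuousD f g : ccontinuous f -> ccontinuous g ->
  ccontinuous (fun x => f x + g x).
Proof.
move=> [f1 f2] [g1 g2]; split.
  by under eq_fun do rewrite complex_ReD; exact: continuous_addf.
by under eq_fun do rewrite complex_ImD; exact: continuous_addf.
Qed.

Lemma ccontinuousM f g : ccontinuous f -> ccontinuous g ->
  ccontinuous (fun x => f x * g x).
Proof.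
move=> [f1 f2] [g1 g2]; split.
  have -> : (fun y => complex.Re (f y * g y)) = (fun y =>
      complex.Re (f y) * complex.Re (g y) - complex.Im (f y) * complex.Im (g y)).
    by apply/funext => y; case: (f y) => a b; case: (g y).
  by apply: continuous_subf; exact: continuous_mulf.
have -> : (fun y => complex.Im (f y * g y)) = (fun y =>
    complex.Re (f y) * complex.Im (g y) + complex.Im (f y) * complex.Re (g y)).
  by apply/funext => y; case: (f y) => a b; case: (g y).
by apply: continuous_addf; exact: continuous_mulf.
Qed.

Lemma ccontinuous_sum n (F : nat -> R -> R[i]) :
  (forall i, ccontinuous (F i)) -> ccontinuous (fun x => \sum_(i < n) F i x).
Proof.
move=> FC; elim: n => [|n IH].
  under eq_fun do rewrite big_ord0.
  exact: ccontinuous_cst.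
by under eq_fun do rewrite big_ord_recr; exact: ccontinuousD.
Qed.

Lemma ccontinuous_real h : continuous h -> ccontinuous (fun x => (h x)%:C).
Proof. by move=> hc; split => x; [exact: hc|exact: cvg_cst]. Qed.

Lemma continuous_normc f : ccontinuous f -> continuous (fun x => normc (f x)).
Proof.
move=> [f1 f2] x.
have -> : (fun y => normc (f y)) = (fun y => Num.sqrt
    (complex.Re (f y) * complex.Re (f y) + complex.Im (f y) * complex.Im (f y))).
  by apply/funext => y; rewrite /Normc.normc; case: (f y) => a b; rewrite -!expr2.
apply: (@continuous_cvg R R R _ _ _ Num.sqrt); first exact: sqrt_continuous.
by apply: (continuous_addf (continuous_mulf f1 f1) (continuous_mulf f2 f2)).
Qed.

Lemma ccontinuous_expi (u : R) : ccontinuous (fun x => expi (u * x)).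
Proof.
have hu : continuous (fun x : R => u * x).
  by apply: continuous_mulf => x; [exact: cvg_cst|exact: cvg_id].
split => x.
  by apply: (@continuous_cvg R R R _ _ _ cos); [exact: continuous_cos|exact: hu].
by apply: (@continuous_cvg R R R _ _ _ sin); [exact: continuous_sin|exact: hu].
Qed.

Lemma ccontinuous_expi1 : ccontinuous (fun x : R => expi x).
Proof. by split => x; [exact: continuous_cos|exact: continuous_sin]. Qed.

Lemma ccontinuousX f n : ccontinuous f -> ccontinuous (fun x => f x ^+ n).
Proof.
move=> fc; elim: n => [|n IH].
  by under eq_fun do rewrite expr0; exact: ccontinuous_cst.
by under eq_fun do rewrite exprS; exact: ccontinuousM.
Qed.

Lemma ccontinuous_poly (p : {poly R[i]}) : ccontinuous (fun x => p.[expi x]).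
Proof.
under eq_fun do rewrite horner_coef.
apply: (@ccontinuous_sum _ (fun i x => p`_i * expi x ^+ i)) => i.
apply: ccontinuousM; first exact: ccontinuous_cst.
exact/ccontinuousX/ccontinuous_expi1.
Qed.

Definition period : set R := `[0, 2 * pi].

Lemma measurable_period : measurable period.
Proof. exact: measurable_itv. Qed.

Lemma integrable_itv_continuous (a b : R) h : continuous h ->
  lebesgue_measure.-integrable `[a, b] (EFin \o h).
Proof.
move=> hc; apply: continuous_compact_integrable; first exact: segment_compact.
exact: continuous_subspaceT.
Qed.

Definition rint h : R := \int[lebesgue_measure]_(x in period) h x.

Definition cint f : R[i] :=
  rint (fun x => complex.Re (f x)) +i* rint (fun x => complex.Im (f x)).

Lemma rintD h k : continuous h -> continuous k ->
  rint (fun x => h x + k x) = rint h + rint k.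
Proof.
have mp := measurable_period.
by move=> hc kc; rewrite /rint RintegralD//; exact: integrable_itv_continuous.
Qed.

Lemma rintZ (a : R) h : continuous h -> rint (fun x => a * h x) = a * rint h.
Proof.
have mp := measurable_period.
by move=> hc; rewrite /rint RintegralZl//; exact: integrable_itv_continuous.
Qed.

Lemma rint_cst (a : R) : rint (fun=> a) = a * (2 * pi).
Proof.
rewrite /rint Rintegral_cst; last exact: measurable_period.
by rewrite /period /= lebesgue_measure_itv /= lte_fin mulr_gt0 ?pi_gt0// oppr0 addr0.
Qed.

Lemma le_rint h k : continuous h -> continuous k ->
  (forall x, 0 <= x <= 2 * pi -> h x <= k x) -> rint h <= rint k.
Proof.
move=> hc kc hk; apply: le_Rintegral.
- exact: measurable_period.
- exact: integrable_itv_continuous.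
- exact: integrable_itv_continuous.
- by move=> x; rewrite /period /= in_itv /=; exact: hk.
Qed.

Lemma cintD f g : ccontinuous f -> ccontinuous g ->
  cint (fun x => f x + g x) = cint f + cint g.
Proof.
move=> [f1 f2] [g1 g2]; rewrite /cint.
under [X in rint X]eq_fun do rewrite complex_ReD.
under [X in _ +i* rint X]eq_fun do rewrite complex_ImD.
by rewrite !rintD.
Qed.

Lemma cintZ (a : R[i]) f : ccontinuous f ->
  cint (fun x => a * f x) = a * cint f.
Proof.
move=> [f1 f2]; case: a => a b; rewrite /cint.
have h1 : continuous (fun x => - complex.Im (f x)).
  exact: continuous_oppf.
have Z (r : R) h : continuous h -> continuous (fun x => r * h x).
  by move=> hc; apply: continuous_mulf hc => x; exact: cvg_cst.
have -> : (fun x => complex.Re ((a +i* b) * f x)) =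
    (fun x => a * complex.Re (f x) + b * - complex.Im (f x)).
  by apply/funext => x; case: (f x) => c d /=; rewrite mulrN.
have -> : (fun x => complex.Im ((a +i* b) * f x)) =
    (fun x => a * complex.Im (f x) + b * complex.Re (f x)).
  by apply/funext => x; case: (f x) => c d /=.
rewrite !rintD ?rintZ//; try exact: Z.
have -> : rint (fun x => - complex.Im (f x)) = - rint (fun x => complex.Im (f x)).
  by rewrite -mulN1r -rintZ//; under [in RHS]eq_fun do rewrite mulN1r.
by simpc; congr (_ +i* _); ring.
Qed.

Lemma cint_sum n (F : nat -> R -> R[i]) : (forall i, ccontinuous (F i)) ->
  cint (fun x => \sum_(i < n) F i x) = \sum_(i < n) cint (F i).
Proof.
move=> FC; elim: n => [|n IH].
  under [in LHS]eq_fun do rewrite big_ord0.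
  rewrite big_ord0 /cint /=.
  by rewrite !rint_cst mul0r.
under [in LHS]eq_fun do rewrite big_ord_recr.
by rewrite cintD//= ?IH ?big_ord_recr//; exact: ccontinuous_sum.
Qed.

Lemma cint_real h : cint (fun x => (h x)%:C) = (rint h)%:C.
Proof. by rewrite /cint /= rint_cst mul0r. Qed.

Lemma normc_cint_le f : ccontinuous f ->
  normc (cint f) <= rint (fun x => normc (f x)).
Proof.
move=> fc; have [u u1] := phase_align 1 (cint f).
have [->|_ uE] := eqVneq (cint f) 0.
  move=> _; rewrite normc_zero; apply: Rintegral_ge0 => x _; exact: normc_ge0.
have ufc : ccontinuous (fun x => u * f x).
  by apply: ccontinuousM => //; exact: ccontinuous_cst.
suff : normc (cint f) <= complex.Re (cint (fun x => u * f x)).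
  move/le_trans; apply; rewrite /cint /=; apply: le_rint.
  - exact: ufc.1.
  - exact: continuous_normc.
  - by move=> x _; rewrite (le_trans (Re_normc_le _))// normc_mul u1 mul1r.
rewrite cintZ//; move: uE; set z := u * cint f.
have : normc z = normc (cint f) by rewrite normc_mul u1 mul1r.
rewrite normc_one => <- /(congr1 (fun y => y ^+ 2)).
have := sqr_normc_ReIm z; have := sqr_normc_ReIm (1 + z).
rewrite complex_ReD complex_ImD /= add0r.
by case: (z) => a b; nra.
Qed.

Lemma rint_FTC (a b : R) h (H : R -> R) : a < b -> continuous h ->
  (forall x : R, is_derive x (1 : R) H (h x)) ->
  \int[lebesgue_measure]_(x in `[a, b]) h x = H b - H a.
Proof.
move=> ab hc Hh; rewrite /Rintegral (@continuous_FTC2 _ h H)//.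
- exact: continuous_subspaceT.
- have Hc : continuous H.
    move=> x; apply: differentiable_continuous; apply/derivable1_diffP.
    by have [] := Hh x.
  split; first by move=> x _; have [] := Hh x.
  + exact/cvg_at_right_filter/Hc.
  + exact/cvg_at_left_filter/Hc.
- by move=> x _; rewrite derive1E; have [_ ->] := Hh x.
Qed.

End complex_integral.

(** * Fourier coefficients of a bump *)

Section derivatives.
Context {R : realType}.
Implicit Types (f g : R -> R) (x u : R).

Lemma is_derive_val f x (d d' : R) :
  is_derive x (1 : R) f d -> d = d' -> is_derive x (1 : R) f d'.
Proof. by move=> fd <-. Qed.

Lemma is_derive_mulf f g x (df dg : R) :
  is_derive x (1 : R) f df -> is_derive x (1 : R) g dg ->
  is_derive x (1 : R) (fun y => f y * g y) (df * g x + f x * dg).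
Proof.
move=> hf hg.
have -> : df * g x + f x * dg = f x *: dg + g x *: df.
  by rewrite addrC [df * _]mulrC.
exact: (is_deriveM hf hg).
Qed.

Lemma is_derive_addf f g x (df dg : R) :
  is_derive x (1 : R) f df -> is_derive x (1 : R) g dg ->
  is_derive x (1 : R) (fun y => f y + g y) (df + dg).
Proof. by move=> hf hg; exact: (is_deriveD hf hg). Qed.

Lemma is_derive_linear u x : is_derive x (1 : R) (fun y => u * y) u.
Proof.
have := is_derive_mulf (is_derive_cst u x 1) (is_derive_id x 1).
by rewrite mul0r add0r mulr1.
Qed.

Lemma is_derive_sin_linear u x :
  is_derive x (1 : R) (fun y => sin (u * y)) (u * cos (u * x)).
Proof.
have := is_derive1_comp (is_derive_sin (u * x)) (is_derive_linear u x).
by rewrite [_ * u]mulrC.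
Qed.

Lemma is_derive_cos_linear u x :
  is_derive x (1 : R) (fun y => cos (u * y)) (- (u * sin (u * x))).
Proof.
have := is_derive1_comp (is_derive_cos (u * x)) (is_derive_linear u x).
by rewrite [_ * u]mulrC mulrN.
Qed.

End derivatives.

Section weighted_coefficients.
Context {R : realType}.
Implicit Types (w : R -> R) (m : int) (p : {poly R[i]}).

Definition wave m (x : R) : R[i] := expi (m%:~R * x).

Lemma wave_nat (n : nat) x : wave n%:Z x = expi x ^+ n.
Proof. by rewrite /wave -pmulrn expi_nat. Qed.

Lemma waveD m m' x : wave (m + m') x = wave m x * wave m' x.
Proof. by rewrite /wave intrD mulrDl expiD. Qed.

Lemma waveN m x : wave (- m) x = (wave m x)^*.
Proof. by rewrite /wave intrN mulNr expiN. Qed.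

Lemma normc_wave m x : normc (wave m x) = 1.
Proof. exact: normc_expi. Qed.

Lemma ccontinuous_wave m : ccontinuous (wave m).
Proof. exact: ccontinuous_expi. Qed.

(** The Fourier coefficient of index [- m] of [w], up to the factor [2 * pi]. *)
Definition wcoef w m : R[i] := cint (fun x => (w x)%:C * wave m x).

Lemma rint_sqr_poly w p n : continuous w -> (size p <= n)%N ->
  (rint (fun x => w x * normc p.[expi x] ^+ 2))%:C =
  \sum_(i < n) \sum_(j < n) p`_i * (p`_j)^* * wcoef w (i%:Z - j%:Z).
Proof.
move=> wc pn; rewrite -cint_real.
have wC := ccontinuous_real wc.
have -> : (fun x => (w x * normc p.[expi x] ^+ 2)%:C) = (fun x =>
    \sum_(i < n) \sum_(j < n)
      p`_i * (p`_j)^* * ((w x)%:C * wave (i%:Z - j%:Z) x)).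
  apply/funext => x; rewrite rmorphM /= -mul_conjc (horner_coef_wide _ pn).
  rewrite rmorph_sum mulr_suml mulr_sumr; apply: eq_bigr => i _.
  rewrite !mulr_sumr; apply: eq_bigr => j _.
  rewrite waveD waveN !wave_nat rmorphM /=.
  by ring.
have cc (i j : nat) : ccontinuous
    (fun x => p`_i * (p`_j)^* * ((w x)%:C * wave (i%:Z - j%:Z) x)).
  apply: ccontinuousM; first exact: ccontinuous_cst.
  by apply: ccontinuousM => //; exact: ccontinuous_wave.
rewrite (@cint_sum _ n (fun i x => \sum_(j < n)
    p`_i * (p`_j)^* * ((w x)%:C * wave (i%:Z - j%:Z) x))); last first.
  move=> i; apply: (@ccontinuous_sum _ n (fun j x =>
    p`_i * (p`_j)^* * ((w x)%:C * wave (i%:Z - j%:Z) x))).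
  by move=> j; exact: cc.
apply: eq_bigr => i _.
rewrite (@cint_sum _ n (fun j x =>
  p`_i * (p`_j)^* * ((w x)%:C * wave (i%:Z - j%:Z) x)))//.
apply: eq_bigr => j _; rewrite cintZ//.
by apply: ccontinuousM => //; exact: ccontinuous_wave.
Qed.

Lemma wcoef1 m : wcoef (fun=> 1) m = if m == 0 then (2 * pi)%:C else 0.
Proof.
have [->|m0] := eqVneq m 0.
  rewrite /wcoef; have -> : (fun x : R => 1%:C * wave 0 x) = (fun=> 1%:C).
    by apply/funext => x; rewrite /wave mul0r expi0 mulr1.
  by rewrite (cint_real (fun=> 1)) rint_cst mul1r.
rewrite /wcoef /wave; set u : R := m%:~R.
have u0 : u != 0 by rewrite intr_eq0.
have p0 := pi_gt0 R.
have i2 : (0 : R) < 2 * pi by rewrite mulr_gt0.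
have per : cos (u * (2 * pi)) = 1 /\ sin (u * (2 * pi)) = 0.
  by have := @expi_2pi R m => -[].
have -> : (fun x => 1%:C * expi (u * x)) = (fun x => expi (u * x)).
  by apply/funext => x; rewrite mul1r.
have [c1 c2] := ccontinuous_expi u.
have D1 (x : R) : is_derive x (1 : R) (fun x => u^-1 * sin (u * x)) (cos (u * x)).
  have := is_derive_mulf (is_derive_cst u^-1 x 1) (is_derive_sin_linear u x).
  by rewrite mul0r add0r mulKf.
have D2 (x : R) : is_derive x (1 : R) (fun x => - u^-1 * cos (u * x)) (sin (u * x)).
  have := is_derive_mulf (is_derive_cst (- u^-1) x 1) (is_derive_cos_linear u x).
  by rewrite mul0r add0r mulrNN mulKf.
rewrite /cint /rint /period /= (rint_FTC i2 c1 D1) (rint_FTC i2 c2 D2).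
by rewrite /= per.1 per.2 !mulr0 sin0 cos0 mulr0 !subrr.
Qed.

Lemma parseval p n : (size p <= n)%N ->
  rint (fun x => normc p.[expi x] ^+ 2) = 2 * pi * \sum_(i < n) normc p`_i ^+ 2.
Proof.
move=> pn; apply: (@complexI R).
have c1 : continuous (fun _ : R => 1 : R) by move=> x; exact: cvg_cst.
have := rint_sqr_poly c1 pn; under eq_fun do rewrite mul1r.
move=> ->; rewrite rmorphM rmorph_sum mulr_sumr.
apply: eq_bigr => i _; rewrite (bigD1 i)//= big1 ?addr0.
  by rewrite subrr wcoef1 eqxx mul_conjc mulrC.
move=> j ji; rewrite wcoef1 subr_eq0 eqz_nat.
by rewrite -val_eqE /= eq_sym in ji; rewrite (negPf ji) mulr0.
Qed.

End weighted_coefficients.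

Section bump.
Context {R : realType}.
Variables s t : R.
Hypotheses (s0 : 0 <= s) (st : s < t) (t2 : t <= 2 * pi).

(** Continuous on the line and twice differentiable inside its support: this is
    all that summable Fourier coefficients require. *)
Definition bump (x : R) : R := Num.max 0 ((x - s) * (t - x)).

Lemma continuous_bump : continuous bump.
Proof.
have c : continuous (fun x : R => (x - s) * (t - x)).
  by apply: continuous_mulf; apply: continuous_subf => x;
    (exact: cvg_id || exact: cvg_cst).
by move=> x; exact: (@continuous_max R R (fun=> 0 : R^o)
  (fun y => (y - s) * (t - y)) x (cvg_cst _) (c x)).
Qed.

Lemma bump_ge0 x : 0 <= bump x.
Proof. by rewrite le_max lexx. Qed.

Lemma bump_le x : bump x <= (t - s) ^+ 2.
Proof.
rewrite ge_max sqr_ge0 /=.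
have := sqr_ge0 (t - x); have := sqr_ge0 (x - s); rewrite !expr2.
by nra.
Qed.

Lemma bump_out x : x \notin `]s, t[ -> bump x = 0.
Proof.
rewrite in_itv /= negb_and -!leNgt => h; apply/max_idPl.
have st' := ltW st; case/orP: h => h.
  by rewrite mulr_le0_ge0// ?subr_le0 ?subr_ge0// (le_trans h).
by rewrite mulr_ge0_le0// ?subr_le0 ?subr_ge0// (le_trans st').
Qed.

Lemma bump_in x : x \in `[s, t] -> bump x = (x - s) * (t - x).
Proof.
rewrite in_itv /= => /andP[h1 h2]; apply/max_idPr.
by rewrite mulr_ge0 ?subr_ge0.
Qed.

Lemma bump_ge (s' t' : R) x : s < s' -> t' < t -> x \in `]s', t'[ ->
  (s' - s) * (t - t') <= bump x.
Proof.
rewrite in_itv /= => h1 h2 /andP[h3 h4]; rewrite le_max; apply/orP; right.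
by apply: ler_pM; lra.
Qed.

Lemma rint_bump h : rint (fun x => bump x * h x) =
  \int[lebesgue_measure]_(x in `[s, t]) ((x - s) * (t - x) * h x).
Proof.
rewrite /rint Rintegral_mkcond [RHS]Rintegral_mkcond.
congr Rintegral; apply/funext => x; rewrite !patchE.
have [xst|xst] := boolP (x \in `[s, t]).
  have -> : x \in [set` `[s, t]] by rewrite inE.
  have -> : x \in period; last by rewrite bump_in.
  rewrite inE /period /=; move: xst; rewrite !in_itv /= => /andP[h1 h2].
  by rewrite (le_trans s0 h1) (le_trans h2 t2).
have -> : (x \in [set` `[s, t]]) = false.
  by apply/negbTE; rewrite notin_setE /=; exact/negP.
case: ifP => // _; rewrite bump_out ?mul0r//.
by apply: contra xst; exact: subset_itv_oo_cc.
Qed.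

Let poly_deriv (x : R) :
  is_derive x (1 : R) (fun y => (y - s) * (t - y)) (s + t - 2 * x).
Proof.
have h1 := is_derive_addf (is_derive_id x (1 : R)) (is_derive_cst (- s) x (1 : R)).
have h2 := is_derive_addf (is_derive_cst t x (1 : R)) (is_derive_linear (-1) x).
have := is_derive_mulf h1 h2.
have -> : (fun y : R => (y - s) * (t + -1 * y)) = (fun y => (y - s) * (t - y)).
  by apply/funext => y; rewrite mulN1r.
by move/is_derive_val; apply; rewrite /=; ring.
Qed.

Let deriv_deriv (x : R) : is_derive x (1 : R) (fun y => s + t - 2 * y) (- 2).
Proof.
have := is_derive_addf (is_derive_cst (s + t) x (1 : R)) (is_derive_linear (-2) x).
have -> : (fun y : R => s + t + -2 * y) = (fun y => s + t - 2 * y).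
  by apply/funext => y; rewrite mulNr.
by move/is_derive_val; apply; rewrite /=; ring.
Qed.

Let scaled_sin (k u x : R) :
  is_derive x (1 : R) (fun y => k * sin (u * y)) (k * (u * cos (u * x))).
Proof.
have := is_derive_mulf (is_derive_cst k x 1) (is_derive_sin_linear u x).
by rewrite mul0r add0r.
Qed.

Let scaled_cos (k u x : R) :
  is_derive x (1 : R) (fun y => k * cos (u * y)) (- (k * (u * sin (u * x)))).
Proof.
have := is_derive_mulf (is_derive_cst k x 1) (is_derive_cos_linear u x).
by rewrite mul0r add0r mulrN.
Qed.

(** Two integrations by parts: the bump vanishes at [s] and [t], and its second
    derivative is constant in between. *)
Lemma rint_bump_wave (u : R) : u != 0 ->
  rint (fun x => bump x * cos (u * x)) =
    ((s - t) * (cos (u * t) + cos (u * s)) +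
     2 * (sin (u * t) - sin (u * s)) / u) / u ^+ 2 /\
  rint (fun x => bump x * sin (u * x)) =
    ((s - t) * (sin (u * t) + sin (u * s)) -
     2 * (cos (u * t) - cos (u * s)) / u) / u ^+ 2.
Proof.
move=> u0; have [c1 c2] := ccontinuous_expi u.
have c : continuous (fun x : R => (x - s) * (t - x)).
  by apply: continuous_mulf; apply: continuous_subf => x;
    (exact: cvg_id || exact: cvg_cst).
have D1 (x : R) : is_derive x (1 : R)
    (fun y => (y - s) * (t - y) * (u^-1 * sin (u * y)) +
       (s + t - 2 * y) * (u ^- 2 * cos (u * y)) + 2 * u ^- 3 * sin (u * y))
    ((x - s) * (t - x) * cos (u * x)).
  have h1 := is_derive_mulf (poly_deriv x) (scaled_sin u^-1 u x).
  have h2 := is_derive_mulf (deriv_deriv x) (scaled_cos (u ^- 2) u x).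
  have := is_derive_addf (is_derive_addf h1 h2) (scaled_sin (2 * u ^- 3) u x).
  by move/is_derive_val; apply; rewrite /=; field.
have D2 (x : R) : is_derive x (1 : R)
    (fun y => (y - s) * (t - y) * (- u^-1 * cos (u * y)) +
       (s + t - 2 * y) * (u ^- 2 * sin (u * y)) + - 2 * u ^- 3 * cos (u * y))
    ((x - s) * (t - x) * sin (u * x)).
  have h1 := is_derive_mulf (poly_deriv x) (scaled_cos (- u^-1) u x).
  have h2 := is_derive_mulf (deriv_deriv x) (scaled_sin (u ^- 2) u x).
  have := is_derive_addf (is_derive_addf h1 h2) (scaled_cos (- 2 * u ^- 3) u x).
  by move/is_derive_val; apply; rewrite /=; field.
rewrite !rint_bump (rint_FTC st (continuous_mulf c c1) D1).
rewrite (rint_FTC st (continuous_mulf c c2) D2).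
by split; field.
Qed.

Definition bump_coef := wcoef bump.

(** The boundary terms of the integrations by parts add up to at most
    [(4 * (t - s) + 8) / n ^ 2], and [n ^ 2] is at least [(n + 1) * (n + 2) / 6];
    the last summand takes care of [n = 0]. *)
Definition bump_decay : R := 24 * (t - s) + 48 + 4 * pi * (t - s) ^+ 2.

Lemma bump_decay_ge0 : 0 <= bump_decay.
Proof.
have d0 : 0 <= t - s by rewrite subr_ge0 ltW.
by rewrite !addr_ge0// mulr_ge0 ?sqr_ge0// mulr_ge0// pi_ge0.
Qed.

(** The bound is quadratic, and it is written with the product of two
    consecutive integers so that its tails telescope. *)
Lemma normc_bump_coef_le m : normc (bump_coef m) <=
  bump_decay / ((`|m|%N.+1)%:R * (`|m|%N.+2)%:R).
Proof.
have d0 : 0 < t - s by rewrite subr_gt0.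
have p0 := pi_gt0 R.
have P0 : 0 <= 4 * pi * (t - s) ^+ 2 by rewrite mulr_ge0 ?sqr_ge0// mulr_ge0// ltW.
have [->|m0] := eqVneq m 0.
  rewrite absz0 mul1r.
  have -> : bump_coef 0 = (rint bump)%:C.
    rewrite -cint_real /bump_coef /wcoef; congr cint; apply/funext => x.
    by rewrite /wave mul0r expi0 mulr1.
  rewrite normc_real ger0_norm; last by apply: Rintegral_ge0 => x _; exact: bump_ge0.
  rewrite ler_pdivlMr//.
  have : rint bump <= rint (fun=> (t - s) ^+ 2).
    apply: le_rint; [exact: continuous_bump| |].
      by move=> x; exact: cvg_cst.
    by move=> x _; exact: bump_le.
  by rewrite rint_cst /bump_decay; lra.
set n := `|m|%N; set u : R := m%:~R.
have u0 : u != 0 by rewrite intr_eq0.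
have n1 : 1 <= n%:R :> R by rewrite ler1n absz_gt0.
have uE : u ^+ 2 = n%:R ^+ 2 by rewrite -real_normK ?num_real// -intr_norm -abszE -pmulrn.
have au : 1 <= `|u| by rewrite -intr_norm -abszE -pmulrn.
have tri (a b c d : R) : `|a| <= 1 -> `|b| <= 1 -> `|c| <= 1 -> `|d| <= 1 ->
    `|((s - t) * (a + b) + 2 * (c - d) / u) / u ^+ 2| <= (2 * (t - s) + 4) / n%:R ^+ 2.
  move=> a1 b1 c1 e1; rewrite normrM normfV normrX -(normrX 2 u) uE.
  rewrite [`|n%:R ^+ 2|]ger0_norm ?sqr_ge0// ler_pM2r ?invr_gt0 ?exprn_gt0//; last lra.
  rewrite (le_trans (ler_normD _ _))// lerD//.
    rewrite normrM distrC (gtr0_norm d0) mulrC ler_pM2r//.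
    by rewrite (le_trans (ler_normD _ _))//; lra.
  rewrite normrM normfV ler_pdivrMr ?(lt_le_trans _ au)// normrM.
  rewrite ger0_norm//; have := ler_normB c d.
  by nra.
have [Ec Es] := rint_bump_wave u0.
have Re_le : `|complex.Re (bump_coef m)| <= (2 * (t - s) + 4) / n%:R ^+ 2.
  have -> : complex.Re (bump_coef m) = rint (fun x => bump x * cos (u * x)).
    rewrite /bump_coef /wcoef /=; congr rint; apply/funext => x /=.
    by rewrite mul0r subr0.
  by rewrite Ec tri ?cos_max ?sin_max.
have Im_le : `|complex.Im (bump_coef m)| <= (2 * (t - s) + 4) / n%:R ^+ 2.
  have -> : complex.Im (bump_coef m) = rint (fun x => bump x * sin (u * x)).
    rewrite /bump_coef /wcoef /=; congr rint; apply/funext => x /=.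
    by rewrite mul0r addr0.
  by rewrite Es -mulNr -mulrN opprB tri ?cos_max ?sin_max.
rewrite (le_trans (normc_le_ReIm _))// (le_trans (lerD Re_le Im_le))//.
have nE1 : n.+1%:R = n%:R + 1 :> R by rewrite natr1.
have nE2 : n.+2%:R = n%:R + 1 + 1 :> R by rewrite !natr1.
rewrite nE1 nE2 -mulrDl.
rewrite ler_pdivrMr ?exprn_gt0//; last lra.
rewrite mulrAC ler_pdivlMr ?mulr_gt0//; try lra.
have : 6 * n%:R ^+ 2 >= (n%:R + 1) * (n%:R + 1 + 1) :> R by nra.
have : 0 <= n%:R ^+ 2 :> R by exact: sqr_ge0.
rewrite /bump_decay.
set P := 4 * pi * (t - s) ^+ 2 in P0 *.
set N := n%:R ^+ 2; set N' := (_ + 1) * _.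
move=> h1 h2; have h3 : (4 * (t - s) + 8) * N' <= (4 * (t - s) + 8) * (6 * N).
  by rewrite ler_pM2l; lra.
have h4 : 0 <= P * N by rewrite mulr_ge0.
by nra.
Qed.

End bump.

(** * Power series with bounded means over an arc *)

Section telescoping.
Context {R : realType}.

Lemma telescope_sum (q n : nat) :
  \sum_(k < n) ((q + k).+1%:R * (q + k).+2%:R)^-1 <= q.+1%:R^-1 :> R.
Proof.
have -> : \sum_(k < n) ((q + k).+1%:R * (q + k).+2%:R)^-1 =
    q.+1%:R^-1 - (q + n).+1%:R^-1 :> R.
  elim: n => [|n IH]; first by rewrite big_ord0 addn0 subrr.
  rewrite big_ord_recr IH /= addnS.
  have h1 : (q + n).+1%:R != 0 :> R by rewrite pnatr_eq0.
  have h2 : (q + n).+2%:R = (q + n).+1%:R + 1 :> R by rewrite natr1.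
  have h3 : (q + n).+1%:R + 1 != 0 :> R by rewrite natr1 pnatr_eq0.
  have h4 : q.+1%:R != 0 :> R by rewrite pnatr_eq0.
  rewrite h2; move: (q + n).+1%:R q.+1%:R h1 h3 h4 => u v h1 h3 h4.
  by field; rewrite h1 h3 h4.
by rewrite gerBl invr_ge0.
Qed.

Lemma le_addsqr_div (x e : R) : 0 < e -> x <= e + x ^+ 2 / e.
Proof.
by move=> e0; rewrite -(ler_pM2r e0) mulrDl divfK ?gt_eqF//; nra.
Qed.

Lemma inv_natS_small (A e : R) : 0 <= A -> 0 < e ->
  exists n0 : nat, forall n : nat, (n0 <= n)%N -> A / n.+1%:R <= e.
Proof.
move=> A0 e0; exists (Num.Def.truncn (A / e)) => n hn.
rewrite ler_pdivrMr// mulrC -ler_pdivrMr// (le_trans (ltW (truncnS_gt _)))//.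
by rewrite ler_nat ltnS.
Qed.

End telescoping.

Section circle_continuity.
Context {R : realType}.

Lemma normc_radius (r x : R) : 0 < r -> normc (r%:C * expi x) = r.
Proof. by move=> r0; rewrite normc_mul normc_real normc_expi mulr1 gtr0_norm. Qed.

Lemma continuous_normc_power_series (M r : R) (a : nat -> R[i]) : 0 < r < 1 ->
  bounded_coefs M a -> continuous (fun x => normc (power_series a (r%:C * expi x))).
Proof.
move=> /andP[r0 r1] aM.
have M0 : 0 <= M by exact: le_trans (normc_ge0 _) (aM 0%N).
have fz x := normc_radius x r0.
move=> x; apply/cvgrPdist_le => e e0.
pose l := M / (1 - r) / (1 - r).
have l0 : 0 <= l by rewrite !divr_ge0// subr_ge0 ltW.
have d0 : 0 < e / (l + 1) by rewrite divr_gt0// ltr_wpDl.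
have := expi_cont x d0; apply: filterS => y hy.
apply: (@le_trans _ _ (normc (expi y - expi x) * l)).
  apply: (@le_trans _ _ (normc (power_series a (r%:C * expi y) -
      power_series a (r%:C * expi x)))).
    by rewrite distrC abs_sub_normc_le.
  apply: (le_trans (power_series_lipschitz aM _ _)); rewrite ?fz//.
  rewrite -mulrBr normc_mul normc_real gtr0_norm//.
  by rewrite ler_wpM2r// ler_piMl ?normc_ge0// ltW.
move: (ltW hy); rewrite ler_pdivlMr ?ltr_wpDl// mulrDr mulr1.
by apply: le_trans; rewrite lerDl normc_ge0.
Qed.

End circle_continuity.

Section bounded_means.
Context {R : realType}.
Variables (M s t C1 : R) (a : nat -> R[i]).
Hypotheses (s0 : 0 <= s) (st : s < t) (t2 : t <= 2 * pi).
Hypothesis aM : bounded_coefs M a.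
Hypothesis mean_le : forall r : R, 0 < r < 1 ->
  rint (fun x => bump s t x * normc (power_series a (r%:C * expi x))) <= C1.

Let Phi := bump_coef s t.
Let bd := bump_decay s t.

Let M0 : 0 <= M.
Proof. exact: le_trans (normc_ge0 _) (aM 0%N). Qed.

Let bd0 : 0 <= bd.
Proof. exact: bump_decay_ge0. Qed.

Let A0 : 0 <= M * bd.
Proof. exact: mulr_ge0. Qed.

Let normc_Phi_le m : normc (Phi m) <= bd / (`|m|%N.+1%:R * `|m|%N.+2%:R).
Proof. exact: normc_bump_coef_le. Qed.

Let normc_Phi_le_bd m : normc (Phi m) <= bd.
Proof.
rewrite (le_trans (normc_Phi_le m))// ler_piMr// invf_le1 ?mulr_gt0//.
by rewrite -natrM ler1n.
Qed.

Definition trunc (b : nat -> R[i]) (K : nat) (n : int) : R[i] :=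
  \sum_(k < K) b k * Phi (k%:Z + n).

Let tail_le (b : nat -> R[i]) (q K : nat) : bounded_coefs M b ->
  \sum_(k < K) normc (b k * Phi (q + k)%N%:Z) <= M * bd / q.+1%:R.
Proof.
move=> bM; apply: (@le_trans _ _
    (M * bd * \sum_(k < K) ((q + k).+1%:R * (q + k).+2%:R)^-1)).
  rewrite mulr_sumr; apply: ler_sum => k _.
  by rewrite normc_mul -mulrA ler_pM ?normc_ge0// normc_Phi_le.
by rewrite ler_wpM2l// telescope_sum.
Qed.

Lemma trunc_tail_le (b : nat -> R[i]) (K0 K q : nat) (n : int) :
  bounded_coefs M b -> (K0 <= K)%N -> K0%:Z + n = q%:Z ->
  normc (trunc b K n - trunc b K0 n) <= M * bd / q.+1%:R.
Proof.
move=> bM /subnKC; move: (K - K0)%N => K' <- qE; rewrite /trunc big_split_ord /=.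
rewrite addrAC subrr add0r (le_trans (normc_sum _ _ _))//.
have bM' : bounded_coefs M (fun k => b (K0 + k)%N) by move=> k; exact: bM.
rewrite (le_trans _ (tail_le q K' bM'))//.
by apply: ler_sum => k _; rewrite !PoszD addrAC qE.
Qed.

(** Up to the sign of the index and a factor [2 * pi], the Fourier coefficients
    of the product of the bump with the boundary distribution of the power
    series. *)
Definition local_coef (n : int) : R[i] :=
  xget 0 [set l | tends (fun K => trunc a K n) l].

Lemma local_coef_tends n : tends (fun K => trunc a K n) (local_coef n).
Proof.
rewrite /local_coef; case: xgetP => [l -> //|H]; exfalso.
suff [l hl] : exists l, tends (fun K => trunc a K n) l by exact: H hl.
apply: (@abs_summable_tends R (fun k => a k * Phi (k%:Z + n)) (`|n|%N%:R * (M * bd) + M * bd)).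
move=> K; apply: (@le_trans _ _
    (\sum_(k < `|n|%N + K) normc (a k * Phi (k%:Z + n)))).
  rewrite addnC big_split_ord /= lerDl.
  by apply: sumr_ge0 => i _; exact: normc_ge0.
rewrite big_split_ord /= lerD//.
  have -> : `|n|%N%:R * (M * bd) = \sum_(i < `|n|%N) (M * bd).
    by rewrite sumr_const card_ord mulr_natl.
  by apply: ler_sum => i _; rewrite normc_mul ler_pM ?normc_ge0.
have [q qE] : exists q : nat, `|n|%N%:Z + n = q%:Z.
  case: (n) => m; first by exists (m + m)%N.
  by exists 0%N; rewrite NegzE abszN absz_nat addrN.
have aM' : bounded_coefs M (fun k => a (`|n|%N + k)%N) by move=> k; exact: aM.
apply: (@le_trans _ _ (M * bd / q.+1%:R)).
  rewrite (le_trans _ (tail_le q K aM'))//.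
  by apply: ler_sum => k _; rewrite !PoszD addrAC qE.
by rewrite ler_piMr// invf_le1// ler1n.
Qed.

Lemma local_coef_tail_le (K q : nat) (n : int) : K%:Z + n = q%:Z ->
  normc (local_coef n - trunc a K n) <= M * bd / q.+1%:R.
Proof.
move=> qE; apply/ler_addgt0Pl => e e0.
have [n0 h] := local_coef_tends n e0.
have {}h := h (maxn n0 K) (leq_maxl _ _).
have h' := trunc_tail_le aM (leq_maxr n0 K) qE.
set T := trunc a (maxn n0 K) n in h h' *.
have -> : local_coef n - trunc a K n = (local_coef n - T) + (T - trunc a K n).
  by rewrite addrA subrK.
by rewrite (le_trans (normc_triangle _ _))// lerD// normc_distC.
Qed.

Lemma local_coef_small (e : R) : 0 < e ->
  exists n0 : nat, forall n : nat, (n0 <= n)%N -> normc (local_coef n%:Z) <= e.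
Proof.
move=> e0; have [n0 hn0] := inv_natS_small A0 e0; exists n0 => n n0n.
rewrite (le_trans _ (hn0 n n0n))//.
have := @local_coef_tail_le 0 n n%:Z; rewrite /trunc big_ord0 subr0; apply.
by rewrite add0r.
Qed.

Let abs_coefs (p : {poly R[i]}) : R := \sum_(i < size p) normc p`_i.

Let pairing_dist (c c' : int -> R[i]) L p (d : R) :
  (forall i : nat, normc (c (i%:Z - L%:Z) - c' (i%:Z - L%:Z)) <= d) ->
  normc (pairing c L p - pairing c' L p) <= abs_coefs p * d.
Proof.
move=> H; rewrite /pairing -sumrB /abs_coefs mulr_suml.
rewrite (le_trans (normc_sum _ _ _))//; apply: ler_sum => i _.
by rewrite -mulrBr normc_mul ler_wpM2l ?normc_ge0.
Qed.

Lemma pairing_trunc (b : nat -> R[i]) K L p : pairing (trunc b K) L p =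
  cint (fun x => (bump s t x)%:C * (wave (- L%:Z) x * p.[expi x] *
    (\poly_(k < K) b k).[expi x])).
Proof.
have bc := ccontinuous_real (@continuous_bump R s t).
have -> : (fun x => (bump s t x)%:C * (wave (- L%:Z) x * p.[expi x] *
    (\poly_(k < K) b k).[expi x])) = (fun x => \sum_(i < size p) \sum_(k < K)
     (p`_i * b k) * ((bump s t x)%:C * wave (k%:Z + (i%:Z - L%:Z)) x)).
  apply/funext => x; rewrite (horner_coef p) horner_poly.
  rewrite [wave _ _ * _]mulr_sumr mulr_suml mulr_sumr; apply: eq_bigr => i _.
  rewrite !mulr_sumr; apply: eq_bigr => k _.
  by rewrite !waveD !wave_nat; ring.
have cc (i k : nat) : ccontinuous (fun x =>
    (p`_i * b k) * ((bump s t x)%:C * wave (k%:Z + (i%:Z - L%:Z)) x)).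
  apply: ccontinuousM; first exact: ccontinuous_cst.
  by apply: ccontinuousM => //; exact: ccontinuous_wave.
rewrite (@cint_sum _ (size p) (fun i x => \sum_(k < K)
    (p`_i * b k) * ((bump s t x)%:C * wave (k%:Z + (i%:Z - L%:Z)) x))); last first.
  move=> i; apply: (@ccontinuous_sum _ K (fun k x =>
    (p`_i * b k) * ((bump s t x)%:C * wave (k%:Z + (i%:Z - L%:Z)) x))).
  by move=> k; exact: cc.
rewrite /pairing; apply: eq_bigr => i _; rewrite (@cint_sum _ K (fun k x =>
    (p`_i * b k) * ((bump s t x)%:C * wave (k%:Z + (i%:Z - L%:Z)) x)))//.
rewrite /trunc mulr_sumr; apply: eq_bigr => k _.
rewrite cintZ ?mulrA//; apply: ccontinuousM => //.
exact: ccontinuous_wave.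
Qed.

Let abel (r : R) (k : nat) : R[i] := a k * r%:C ^+ k.

Let abelM r : 0 < r < 1 -> bounded_coefs M (abel r).
Proof.
move=> /andP[r0 r1] k; rewrite normc_mul normc_exp normc_real gtr0_norm//.
by rewrite (le_trans _ (aM k))// ler_piMr ?normc_ge0// exprn_ile1// ltW.
Qed.

Let pairing_abel_le r K L p B : 0 < r < 1 -> 0 <= B ->
  circle_bound p (fun=> B) ->
  normc (pairing (trunc (abel r) K) L p) <=
    B * C1 + B * (r ^+ K * (M / (1 - r)) * rint (bump s t)).
Proof.
move=> r01; have /andP[r0 r1] := r01 => B0 pB.
have bc := @continuous_bump R s t.
have bcC := ccontinuous_real bc.
set S := \poly_(k < K) abel r k.
have Sc := ccontinuous_poly S; have pc := ccontinuous_poly p.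
have fz x := normc_radius x r0.
have fc := continuous_normc_power_series r01 aM.
rewrite pairing_trunc.
apply: (le_trans (normc_cint_le _)).
  apply: ccontinuousM => //; apply: ccontinuousM => //.
  by apply: ccontinuousM => //; exact: ccontinuous_wave.
set T := r ^+ K * (M / (1 - r)).
apply: (@le_trans _ _ (rint (fun x => B *
    (bump s t x * normc (power_series a (r%:C * expi x))) + B * T * bump s t x))).
  apply: le_rint.
  - apply: continuous_normc; apply: ccontinuousM => //; apply: ccontinuousM => //.
    by apply: ccontinuousM => //; exact: ccontinuous_wave.
  - apply: continuous_addf; apply: continuous_mulf.
    + by move=> x; exact: cvg_cst.
    + exact: continuous_mulf.
    + by move=> x; exact: cvg_cst.
    + exact: bc.
  - move=> x xI; rewrite !normc_mul normc_wave mul1r normc_real.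
    rewrite ger0_norm ?bump_ge0//.
    have hS : normc S.[expi x] <= normc (power_series a (r%:C * expi x)) + T.
      have := @power_series_tail R M a (r%:C * expi x) K aM.
      rewrite fz => /(_ r1); rewrite -/T.
      have -> : \sum_(k < K) a k * (r%:C * expi x) ^+ k = S.[expi x].
        rewrite horner_poly; apply: eq_bigr => k _.
        by rewrite exprMn mulrA.
      rewrite normc_distC => h; rewrite addrC -lerBlDr (le_trans _ h)//.
      exact: ler_dist_normc.
    have hp := pB _ xI.
    have -> : B * (bump s t x * normc (power_series a (r%:C * expi x))) +
        B * T * bump s t x =
      bump s t x * (B * (normc (power_series a (r%:C * expi x)) + T)) by ring.
    by rewrite ler_wpM2l ?bump_ge0// ler_pM ?normc_ge0.
rewrite rintD; last 2 first.
- by apply: continuous_mulf; [move=> x; exact: cvg_cst|exact: continuous_mulf].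
- by apply: continuous_mulf => //; move=> x; exact: cvg_cst.
rewrite rintZ; last exact: continuous_mulf.
rewrite rintZ// mulrA lerD// ler_wpM2l//.
exact: mean_le.
Qed.

(** The bounded means pass to the boundary. For [r < 1] the pairing with Abel
    weights is an integral over the arc of the power series against a polynomial,
    hence at most [C1] times the maximum of the latter. The weights are removed on
    a fixed number of terms by letting [r] tend to one; the other terms are small
    uniformly in [r], as the coefficients of the bump are summable. *)
Lemma pairing_local_coef_le L p B : circle_bound p (fun=> B) ->
  normc (pairing local_coef L p) <= C1 * B.
Proof.
move=> pB.
have B0 : 0 <= B.
  rewrite (le_trans (normc_ge0 p.[expi 0]))// pB// lexx /=.
  by rewrite mulr_ge0// pi_ge0.
have P0 : 0 <= abs_coefs p by apply: sumr_ge0 => i _; exact: normc_ge0.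
apply/ler_addgt0Pl => e e0.
have e4 : 0 < e / 4 by rewrite divr_gt0.
have [n0 hn0] := inv_natS_small (mulr_ge0 P0 A0) e4.
pose K0 := (n0 + L)%N.
have qE (i : nat) : K0%:Z + (i%:Z - L%:Z) = (n0 + i)%N%:Z.
  by rewrite /K0 !PoszD; ring.
have hq (i : nat) : M * bd / (n0 + i).+1%:R <= M * bd / n0.+1%:R.
  by rewrite ler_wpM2l// lef_pV2 ?posrE// ler_nat ltnS leq_addr.
have hn : abs_coefs p * (M * bd / n0.+1%:R) <= e / 4.
  by rewrite mulrA hn0.
have d1 : normc (pairing local_coef L p - pairing (trunc a K0) L p) <= e / 4.
  apply: le_trans hn; apply: pairing_dist => i.
  exact: le_trans (local_coef_tail_le (qE i)) (hq i).
have dr0 : 0 <= abs_coefs p * (K0%:R * (M * bd * K0%:R)).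
  by rewrite mulr_ge0// mulr_ge0// mulr_ge0.
have [m hm] := inv_natS_small dr0 e4.
pose r : R := 1 - m.+2%:R^-1.
have m2 : 0 < m.+2%:R^-1 :> R by rewrite invr_gt0.
have m21 : m.+2%:R^-1 < 1 :> R by rewrite invf_lt1// ltr1n.
have r01 : 0 < r < 1 by rewrite /r subr_gt0 m21 gtrBl.
have /andP[r0 r1] := r01.
have d2 : normc (pairing (trunc a K0) L p - pairing (trunc (abel r) K0) L p) <= e / 4.
  apply: (@le_trans _ _ (abs_coefs p * (K0%:R * (M * bd * (K0%:R / m.+2%:R))))).
    apply: pairing_dist => i; rewrite /trunc -sumrB.
    under eq_bigr do rewrite -mulrBl.
    apply: (@normc_le_sum_const _ K0 (fun k => (a k - abel r k) *
      Phi (k%:Z + (i%:Z - L%:Z)))) => k kK.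
    rewrite normc_mul -mulrA [bd * _]mulrC mulrA.
    rewrite ler_pM ?normc_ge0// /abel -{1}[a k]mulr1 -mulrBr normc_mul.
    rewrite ler_pM ?normc_ge0//.
    have -> : 1 - r%:C ^+ k = (1 - r ^+ k)%:C by move: (r) => r'; rewrite rmorphB rmorph1 rmorphXn.
    rewrite normc_real ger0_norm; last first.
      by rewrite subr_ge0 exprn_ile1// ltW.
    have m01 : 0 <= (m.+2%:R^-1 : R) <= 1 by rewrite (ltW m2) (ltW m21).
    rewrite (le_trans (bernoulli_subX k m01))//.
    by rewrite ler_wpM2r ?(ltW m2)// ler_nat ltnW.
  apply: le_trans (hm m.+1 (leqnSn m)).
  by rewrite !mulrA.
pose T := B * (M / (1 - r) * rint (bump s t)).
have T0 : 0 <= T.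
  rewrite mulr_ge0// mulr_ge0 ?divr_ge0 ?subr_ge0 ?(ltW r1)//.
  by apply: Rintegral_ge0 => x _; exact: bump_ge0.
have d0 : 0 < e / 4 / (T + 1) by rewrite divr_gt0// ltr_wpDl.
have r1' : `|r| < 1 by rewrite gtr0_norm.
have /cvgrPdist_le/(_ _ d0)[K1 _ hK1] := cvg_expr r1'.
pose K := maxn K0 K1.
have d3 : normc (pairing (trunc (abel r) K0) L p - pairing (trunc (abel r) K) L p)
    <= e / 4.
  apply: le_trans hn; apply: pairing_dist => i; rewrite normc_distC.
  exact: le_trans (trunc_tail_le (abelM r01) (leq_maxl _ _) (qE i)) (hq i).
have d4 : normc (pairing (trunc (abel r) K) L p) <= C1 * B + e / 4.
  rewrite (le_trans (pairing_abel_le K L r01 B0 pB))// [B * C1]mulrC lerD2l.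
  have -> : B * (r ^+ K * (M / (1 - r)) * rint (bump s t)) = r ^+ K * T.
    by rewrite /T; ring.
  have := hK1 K (leq_maxr _ _); rewrite /= sub0r normrN gtr0_norm ?exprn_gt0//.
  rewrite ler_pdivlMr ?ltr_wpDl// mulrDr mulr1; apply: le_trans.
  by rewrite lerDl ltW// exprn_gt0.
have tri (x y z w : R[i]) :
    normc x <= normc (x - y) + (normc (y - z) + (normc (z - w) + normc w)).
  have -> : normc x = normc ((x - y) + ((y - z) + ((z - w) + w))).
    by congr normc; ring.
  rewrite (le_trans (normc_triangle _ _))// lerD2l.
  rewrite (le_trans (normc_triangle _ _))// lerD2l.
  exact: normc_triangle.
apply: (le_trans (tri _ (pairing (trunc a K0) L p)
  (pairing (trunc (abel r) K0) L p) (pairing (trunc (abel r) K) L p))).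
by lra.
Qed.

End bounded_means.

Section prediction_error.
Context {R : realType}.
Variables (M s t C1 : R) (a : nat -> R[i]).
Hypotheses (s0 : 0 <= s) (st : s < t) (t2 : t <= 2 * pi).
Hypothesis aM : bounded_coefs M a.
Hypothesis mean_le : forall r : R, 0 < r < 1 ->
  rint (fun x => bump s t x * normc (power_series a (r%:C * expi x))) <= C1.

Let M0 : 0 <= M.
Proof. exact: le_trans (normc_ge0 _) (aM 0%N). Qed.

Let A0 : 0 <= M * bump_decay s t.
Proof. by rewrite mulr_ge0// bump_decay_ge0. Qed.

Definition section_poly (N : nat) : {poly R[i]} := \poly_(j < N) a j.

Lemma size_section_poly N : (size (section_poly N) <= N)%N.
Proof. exact: size_poly. Qed.

Lemma weighted_energyE N :
  (rint (fun x => bump s t x * normc (section_poly N).[expi x] ^+ 2))%:C =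
  \sum_(j < N) (a j)^* * trunc s t a N (- j%:Z).
Proof.
rewrite (rint_sqr_poly (@continuous_bump R s t) (size_section_poly N)) exchange_big.
apply: eq_bigr => j _; rewrite /trunc mulr_sumr; apply: eq_bigr => i _.
by rewrite !coef_poly !ltn_ord /bump_coef; ring.
Qed.

(** The energy is a correlation of the coefficients [a] with truncations of the
    local Fourier coefficients. The latter are small in quadratic mean, and the
    errors of truncation, of harmonic order, add up to a negligible amount. *)
Lemma weighted_energy_small (e : R) : 0 < e -> exists N0, forall N, (N0 <= N)%N ->
  rint (fun x => bump s t x * normc (section_poly N).[expi x] ^+ 2) <= N%:R * e.
Proof.
move=> e0.
have C10 : 0 <= C1.
  rewrite (le_trans _ (mean_le (r := 2^-1) _))//.
    by apply: Rintegral_ge0 => x _; rewrite mulr_ge0 ?bump_ge0 ?normc_ge0.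
  by rewrite invr_gt0 ltr0n /= invf_lt1// ltr1n.
set A := M * bump_decay s t; have A0' : 0 <= A := A0.
pose d := e / (2 * M + M * A + 1).
have D0 : 0 < 2 * M + M * A + 1 by rewrite ltr_wpDl// addr_ge0// mulr_ge0.
have d0 : 0 < d by rewrite divr_gt0.
have [N1 hN1] := wiener C10
  (pairing_local_coef_le s0 st t2 aM mean_le) (local_coef_small s0 st t2 aM)
  (exprn_gt0 2 d0).
have MA0 : 0 <= M * A / d by apply: divr_ge0; [exact: mulr_ge0|exact: ltW].
have [N2 hN2] := inv_natS_small MA0 d0.
exists (maxn N1 N2.+1) => -[|N]; rewrite geq_max.
  by rewrite andbF.
move=> /andP[N1N]; rewrite ltnS => N2N.
have c_abs : \sum_(n < N.+1) normc (local_coef s t a (- n%:Z)) <= N.+1%:R * (2 * d).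
  apply: (@le_trans _ _ (\sum_(n < N.+1)
      (d + normc (local_coef s t a (- n%:Z)) ^+ 2 / d))).
    by apply: ler_sum => n _; exact: le_addsqr_div.
  rewrite big_split sumr_const card_ord -mulr_suml /= -[d *+ _]mulr_natl.
  have -> : N.+1%:R * (2 * d) = N.+1%:R * d + N.+1%:R * d by ring.
  rewrite lerD2l ler_pdivrMr// -mulrA -expr2.
  exact: hN1.
have tel : \sum_(n < N.+1) A / (N.+1 - n).+1%:R <= A * (N.+1%:R * d + d^-1).
  rewrite (reindex_inj rev_ord_inj) -mulr_sumr ler_wpM2l//.
  apply: (@le_trans _ _ (\sum_(n < N.+1)
      (d + (n.+2%:R^-1 : R) ^+ 2 / d))).
    apply: ler_sum => n _; have -> : (N.+1 - rev_ord n)%N = n.+1.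
      by rewrite [nat_of_ord (rev_ord n)]/= subKn.
    exact: le_addsqr_div.
  rewrite big_split sumr_const card_ord -mulr_suml /= -[d *+ _]mulr_natl lerD2l.
  rewrite -[leRHS]mul1r ler_wpM2r ?invr_ge0 ?(ltW d0)//.
  rewrite (le_trans _ (le_trans (@telescope_sum R 0 N.+1) _)) ?invr1//.
  apply: ler_sum => n _; rewrite add0n exprVn lef_pV2 ?posrE ?mulr_gt0 ?exprn_gt0//.
  by rewrite expr2 ler_pM2r// ler_nat.
rewrite -[leLHS]ger0_norm; last first.
  by apply: Rintegral_ge0 => x _; rewrite mulr_ge0 ?bump_ge0 ?sqr_ge0.
rewrite -normc_real weighted_energyE (le_trans (normc_sum _ _ _))//.
apply: (@le_trans _ _ (M * \sum_(n < N.+1) (normc (local_coef s t a (- n%:Z)) +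
    A / (N.+1 - n).+1%:R))).
  rewrite mulr_sumr; apply: ler_sum => n _; rewrite normc_mul normc_conj.
  rewrite ler_pM ?normc_ge0//.
  have qE : N.+1%:Z + - n%:Z = (N.+1 - n)%N%:Z by rewrite -subzn// ltnW.
  have := local_coef_tail_le s0 st t2 aM qE; rewrite normc_distC => h.
  by rewrite addrC -lerBlDr (le_trans _ h)// ler_dist_normc.
rewrite big_split /=; apply: (le_trans (ler_wpM2l M0 (lerD c_abs tel))).
have h3 : M * A / d <= N.+1%:R * d.
  by have := hN2 N N2N; rewrite ler_pdivrMr// [d * _]mulrC.
have -> : M * (N.+1%:R * (2 * d) + A * (N.+1%:R * d + d^-1)) =
  N.+1%:R * ((2 * M + M * A) * d) + M * A / d by ring.
apply: (le_trans (lerD (lexx _) h3)).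
rewrite -mulrDr ler_wpM2l//.
have -> : (2 * M + M * A) * d + d = (2 * M + M * A + 1) * d by ring.
by rewrite /d mulrC divfK// gt_eqF.
Qed.

Definition filtered (p : {poly R[i]}) (u : nat -> R[i]) (n : nat) : R[i] :=
  \sum_(k < size p) p`_k * u (n - k)%N.

(** Filtering multiplies the partial sums of the series by [p]: on the arc their
    energy is negligible, and off the arc it is multiplied by [e ^+ 2] at most. *)
Lemma filtered_mean_square (p : {poly R[i]}) (e K : R) : 0 <= K ->
  (forall x, 0 <= x <= 2 * pi -> normc p.[expi x] ^+ 2 <= e ^+ 2 + K * bump s t x) ->
  forall d : R, 0 < d -> exists N0, forall N, (N0 <= N)%N ->
    \sum_(size p <= n < N) normc (filtered p a n) ^+ 2 <=
    N%:R * (e ^+ 2 * M ^+ 2 + d).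
Proof.
move=> K0 pK d d0.
have p0 : (0 : R) < 2 * pi by rewrite mulr_gt0// pi_gt0.
have d1 : 0 < 2 * pi * d / (K + 1).
  by apply: divr_gt0; [exact: mulr_gt0|rewrite ltr_wpDl].
have [N0 hN0] := weighted_energy_small d1.
exists N0 => N N0N; have {hN0} hN := hN0 _ N0N.
set S := section_poly N in hN.
have sz : (size (p * S)%R <= size p + N)%N.
  rewrite (leq_trans (size_polyMleq _ _))// (leq_trans (leq_pred _))//.
  by rewrite leq_add2l size_section_poly.
apply: (@le_trans _ _ (\sum_(n < size p + N) normc (p * S)`_n ^+ 2)).
  have [pN|Np] := leqP (size p) N; last first.
    by rewrite big_geq ?(ltnW Np)//; apply: sumr_ge0 => i _; exact: sqr_ge0.
  rewrite -(big_mkord predT (fun n => normc (p * S)`_n ^+ 2)).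
  rewrite [leRHS](big_cat_nat (n := size p)) ?leq_addr//= ler_wpDl//.
    by apply: sumr_ge0 => i _; exact: sqr_ge0.
  rewrite [leRHS](big_cat_nat (n := N)) ?leq_addl//= ler_wpDr//.
    by apply: sumr_ge0 => i _; exact: sqr_ge0.
  rewrite !big_nat; apply: ler_sum => n /andP[pn nN].
  suff -> : (p * S)`_n = filtered p a n by [].
  rewrite coefM /filtered (big_ord_widen n.+1 (fun k => p`_k * a (n - k)%N)).
    rewrite [RHS]big_mkcond /=; apply: eq_bigr => k _.
    rewrite coef_poly (leq_ltn_trans (leq_subr _ _) nN).
    by case: ltnP => // kp; rewrite nth_default// mul0r.
  exact: leqW.
rewrite -(ler_pM2l p0) -(parseval sz).
have Pc := ccontinuous_poly p; have Sc := ccontinuous_poly S.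
have sqc (q : {poly R[i]}) : continuous (fun x => normc q.[expi x] ^+ 2).
  under eq_fun do rewrite expr2.
  by apply: continuous_mulf; apply: continuous_normc; exact: ccontinuous_poly.
have bc := @continuous_bump R s t.
have cst (y : R) : continuous (fun _ : R => y) by move=> x; exact: cvg_cst.
apply: (@le_trans _ _ (rint (fun x => e ^+ 2 * normc S.[expi x] ^+ 2 +
    K * (bump s t x * normc S.[expi x] ^+ 2)))).
  apply: le_rint; first exact: sqc.
    apply: continuous_addf; apply: continuous_mulf => //.
    exact: continuous_mulf.
  move=> x xI; rewrite hornerM normc_mul exprMn mulrA -mulrDl.
  by rewrite ler_wpM2r ?sqr_ge0// pK.
rewrite rintD; last 2 first.
- exact: continuous_mulf.
- by apply: continuous_mulf => //; exact: continuous_mulf.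
rewrite !rintZ//; last exact: continuous_mulf.
rewrite (parseval (size_section_poly N)).
have -> : 2 * pi * (N%:R * (e ^+ 2 * M ^+ 2 + d)) =
  e ^+ 2 * (2 * pi * (N%:R * M ^+ 2)) + 2 * pi * (N%:R * d) by ring.
rewrite lerD//.
  rewrite ler_wpM2l ?sqr_ge0// ler_pM2l//.
  have -> : N%:R * M ^+ 2 = \sum_(i < N) M ^+ 2.
    by rewrite sumr_const card_ord mulr_natl.
  apply: ler_sum => i _; rewrite coef_poly ltn_ord.
  by rewrite ler_sqr ?nnegrE ?normc_ge0// aM.
apply: (le_trans (ler_wpM2l K0 hN)).
have -> : K * (N%:R * (2 * pi * d / (K + 1))) =
    (2 * pi * (N%:R * d)) * (K / (K + 1)) by ring.
rewrite ler_piMr//; first by rewrite mulr_ge0 ?(ltW p0)// mulr_ge0// ltW.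
by rewrite ler_pdivrMr ?ltr_wpDl// mul1r lerDl.
Qed.

End prediction_error.

(** * Measurability on path spaces *)

Section complex_measurability.
Context {R : realType}.

Lemma open_preimage_lipschitz (f : R[i] -> R) (V : set R) :
  (forall z w, `|f z - f w| <= normc (z - w)) -> open V ->
  open (f @^-1` V : set R[i]^o).
Proof.
move=> fl oV; rewrite openE => z /= Vz.
have : nbhs (f z) V by exact: open_nbhs_nbhs.
move=> /nbhs_ballP[e /= e0 eV]; apply/nbhs_ballP.
exists e%:C => /=; first by rewrite ltcR.
move=> w; rewrite -ball_normE /ball_ /= normE ltcR => zw; apply: eV.
by rewrite -ball_normE /ball_ /= (le_lt_trans (fl _ _)).
Qed.

Lemma Re_lipschitz (z w : R[i]) : `|complex.Re z - complex.Re w| <= normc (z - w).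
Proof. by have := abs_Re_le (z - w); case: z => a b; case: w. Qed.

Lemma Im_lipschitz (z w : R[i]) : `|complex.Im z - complex.Im w| <= normc (z - w).
Proof. by have := abs_Im_le (z - w); case: z => a b; case: w. Qed.

Lemma measurable_open_complex (U : set R[i]^o) :
  open U -> measurable (U : set (borelC R)).
Proof. by move=> oU; apply: sub_gen_smallest. Qed.

Lemma measurable_complex_Re :
  measurable_fun setT (fun z : borelC R => complex.Re z).
Proof.
apply: (measurability _ (RGenOpens.measurableE R)).
move=> _ [_ [a [b ->] <-]]; rewrite setTI; apply: measurable_open_complex.
by apply: open_preimage_lipschitz Re_lipschitz _; exact: interval_open.
Qed.

Lemma measurable_complex_Im :
  measurable_fun setT (fun z : borelC R => complex.Im z).
Proof.
apply: (measurability _ (RGenOpens.measurableE R)).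
move=> _ [_ [a [b ->] <-]]; rewrite setTI; apply: measurable_open_complex.
by apply: open_preimage_lipschitz Im_lipschitz _; exact: interval_open.
Qed.

Let box (q : rat * rat * nat) : set R[i] :=
  [set z | `|complex.Re z - ratr q.1.1| <= q.2.+1%:R^-1] `&`
  [set z | `|complex.Im z - ratr q.1.2| <= q.2.+1%:R^-1].

Let open_bigcup_box (U : set R[i]^o) : open U ->
  U = \bigcup_(q in [set q | box q `<=` U]) box q.
Proof.
move=> oU; apply/seteqP; split; last by move=> z [q /= qU] /qU.
move=> z Uz; have : nbhs (z : R[i]^o) U by exact: open_nbhs_nbhs.
move=> /nbhs_ballP[_ /= /realC_gt0[e e0 ->] eU].
have [n hn] := inv_natS_small (ltW (ltr0n R 4)) (divr_gt0 e0 (ltr0n R 2)).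
have {hn} := hn n (leqnn n); set d := n.+1%:R^-1 => hd.
have d0 : 0 < d by rewrite invr_gt0.
have rat_near (x : R) : exists q : rat, `|x - ratr q| < d.
  have [|q] := @rat_in_itvoo R (x - d) (x + d); first by lra.
  rewrite in_itv /= => /andP[h1 h2]; exists q.
  by rewrite ltr_norml; apply/andP; split; lra.
have [q1 h1] := rat_near (complex.Re z); have [q2 h2] := rat_near (complex.Im z).
exists (q1, q2, n); last by split; exact: ltW.
move=> w /= [] /=; rewrite -/d => w1 w2; apply: eU.
rewrite -ball_normE /ball_ /= normE ltcR (le_lt_trans (normc_le_ReIm _))//.
have -> : complex.Re (z - w) = (complex.Re z - ratr q1) - (complex.Re w - ratr q1).
  by case: z {Uz h1 h2} => a b; case: w {w1 w2} => a' b' /=; ring.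
have -> : complex.Im (z - w) = (complex.Im z - ratr q2) - (complex.Im w - ratr q2).
  by case: z {Uz h1 h2} => a b; case: w {w1 w2} => a' b' /=; ring.
have := ler_normB (complex.Re z - ratr q1) (complex.Re w - ratr q1).
have := ler_normB (complex.Im z - ratr q2) (complex.Im w - ratr q2).
have : 4 * d <= e / 2 by [].
by lra.
Qed.

Lemma measurable_fun_complex d (T : measurableType d) (f : T -> borelC R) :
  measurable_fun setT (fun x => complex.Re (f x)) ->
  measurable_fun setT (fun x => complex.Im (f x)) -> measurable_fun setT f.
Proof.
move=> f1 f2; apply: (measurability _ (erefl : @measurable _ (borelC R) = <<s @open R[i]^o >>)).
move=> _ [U oU <-]; rewrite setTI (open_bigcup_box oU) preimage_bigcup.
rewrite bigcup_mkcond; apply: countable_bigcupT_measurable => // q.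
case: ifP => // _; rewrite preimage_setI; apply: measurableI.
- rewrite -[X in measurable X]setTI.
  have m : measurable_fun setT (fun x => `|complex.Re (f x) - ratr q.1.1|).
    by apply: measurableT_comp => //; apply: measurable_funB.
  exact: measurable_fun_le.
- rewrite -[X in measurable X]setTI.
  have m : measurable_fun setT (fun x => `|complex.Im (f x) - ratr q.1.2|).
    by apply: measurableT_comp => //; apply: measurable_funB.
  exact: measurable_fun_le.
Qed.

End complex_measurability.

Section path_measurability.
Context {R : realType}.

Lemma measurable_coordinate (I : Type) (n : I) :
  measurable_fun setT (fun u : path_space (borelC R) I => u n).
Proof.
move=> _ B mB; rewrite setTI; apply: sub_gen_smallest.
by exists n => //; exists B => //; rewrite setTI.
Qed.

Lemma measurable_to_path d (T : measurableType d) (I : Type)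
    (f : T -> path_space (borelC R) I) :
  (forall n, measurable_fun setT (fun x => f x n : borelC R)) ->
  measurable_fun setT f.
Proof.
move=> fm; apply: (measurability _ (erefl : @measurable _ (path_space (borelC R) I) =
  <<s @cylinders _ (borelC R) I >>)).
move=> _ [_ [n _ [B mB <-]] <-]; rewrite !setTI -comp_preimage.
by rewrite -[X in measurable X]setTI; exact: fm.
Qed.

Lemma measurable_path_shift :
  measurable_fun setT (@path_shift R).
Proof. by apply: measurable_to_path => n; exact: measurable_coordinate. Qed.

End path_measurability.

(** * The zero-one law and the mean square of the prediction error *)

Section prediction_event.
Context {R : realType}.
Local Notation paths := (path_space (borelC R) int).
Implicit Types (u : paths) (p : {poly R[i]}) (n : int).

Definition path_filter p n u : R[i] := \sum_(k < size p) p`_k * u (n - k%:Z).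

Definition sq_error p n u : R := normc (path_filter p n u) ^+ 2.

Lemma sq_error_ge0 p n u : 0 <= sq_error p n u.
Proof. exact: sqr_ge0. Qed.

Lemma sq_error_shift p n u : sq_error p n (path_shift u) = sq_error p (n + 1) u.
Proof.
rewrite /sq_error /path_filter; congr (normc _ ^+ 2); apply: eq_bigr => k _.
by rewrite /path_shift addrAC.
Qed.

Lemma measurable_path_filter_Re p n :
  measurable_fun setT (fun u : paths => complex.Re (path_filter p n u)).
Proof.
have -> : (fun u => complex.Re (path_filter p n u)) = (fun u : paths =>
    \sum_(k < size p) complex.Re (p`_k * u (n - k%:Z))).
  by apply/funext => u; rewrite /path_filter Re_sum.
apply: measurable_sum => k.
have -> : (fun u : paths => complex.Re (p`_k * u (n - k%:Z))) = (fun u : paths =>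
    complex.Re p`_k * complex.Re (u (n - k%:Z)) -
    complex.Im p`_k * complex.Im (u (n - k%:Z))).
  by apply/funext => u; case: (p`_k) => a b; case: (u _).
apply: measurable_funB; apply: measurable_funM => //.
- exact: measurableT_comp measurable_complex_Re (measurable_coordinate _).
- exact: measurableT_comp measurable_complex_Im (measurable_coordinate _).
Qed.

Lemma measurable_path_filter_Im p n :
  measurable_fun setT (fun u : paths => complex.Im (path_filter p n u)).
Proof.
have -> : (fun u => complex.Im (path_filter p n u)) = (fun u : paths =>
    \sum_(k < size p) complex.Im (p`_k * u (n - k%:Z))).
  by apply/funext => u; rewrite /path_filter Im_sum.
apply: measurable_sum => k.
have -> : (fun u : paths => complex.Im (p`_k * u (n - k%:Z))) = (fun u : paths =>
    complex.Re p`_k * complex.Im (u (n - k%:Z)) +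
    complex.Im p`_k * complex.Re (u (n - k%:Z))).
  by apply/funext => u; case: (p`_k) => a b; case: (u _).
apply: measurable_funD; apply: measurable_funM => //.
- exact: measurableT_comp measurable_complex_Im (measurable_coordinate _).
- exact: measurableT_comp measurable_complex_Re (measurable_coordinate _).
Qed.

Lemma measurable_sq_error p n : measurable_fun setT (sq_error p n).
Proof.
have -> : sq_error p n = (fun u => complex.Re (path_filter p n u) ^+ 2 +
    complex.Im (path_filter p n u) ^+ 2).
  by apply/funext => u; rewrite /sq_error sqr_normc_ReIm.
apply: measurable_funD; apply: measurable_funX.
- exact: measurable_path_filter_Re.
- exact: measurable_path_filter_Im.
Qed.

Variables (M : R) (p : {poly R[i]}) (c : R).

Definition bounded_path u := forall n, normc (u n) <= M.

Definition error_bound : R := (\sum_(k < size p) normc p`_k * M) ^+ 2.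

Lemma sq_error_le n u : bounded_path u -> sq_error p n u <= error_bound.
Proof.
move=> uM; rewrite /sq_error /error_bound ler_sqr ?nnegrE ?normc_ge0//; last first.
  apply: sumr_ge0 => k _; rewrite mulr_ge0 ?normc_ge0//.
  exact: le_trans (normc_ge0 _) (uM 0).
rewrite (le_trans (normc_sum _ _ _))//; apply: ler_sum => k _.
by rewrite normc_mul ler_wpM2l ?normc_ge0.
Qed.

(** On bounded paths the shift changes the sums by two bounded boundary terms
    only, which makes this event invariant. *)
Definition small_error_event : set paths :=
  [set u | bounded_path u /\ forall e : R, 0 < e ->
    exists N0, forall N, (N0 <= N)%N ->
      \sum_(n < N) sq_error p n%:Z u <= N%:R * (c + e)].

Lemma small_error_event_shift :
  @path_shift R @^-1` small_error_event = small_error_event.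
Proof.
have bE u : bounded_path (path_shift u) <-> bounded_path u.
  split => uM n; last exact: uM.
  by have := uM (n - 1); rewrite /path_shift subrK.
have sE u N : \sum_(n < N) sq_error p n%:Z (path_shift u) =
    \sum_(n < N) sq_error p n%:Z u + sq_error p N%:Z u - sq_error p 0 u.
  have -> : \sum_(n < N) sq_error p n%:Z u + sq_error p N%:Z u =
    \sum_(n < N.+1) sq_error p n%:Z u by rewrite big_ord_recr.
  rewrite big_ord_recl addrAC subrr add0r; apply: eq_bigr => n _.
  by rewrite sq_error_shift -PoszD addn1.
have main (A B : nat -> R) (K : R) : 0 <= K -> (forall N, A N <= B N + K) ->
    (forall e : R, 0 < e -> exists N0, forall N, (N0 <= N)%N -> B N <= N%:R * (c + e)) ->
    (forall e : R, 0 < e -> exists N0, forall N, (N0 <= N)%N -> A N <= N%:R * (c + e)).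
  move=> K0 AB HB e e0; have e2 : 0 < e / 2 by rewrite divr_gt0.
  have [N1 h1] := HB _ e2; have [N2 h2] := inv_natS_small K0 e2.
  exists (maxn N1 N2.+1) => -[|N]; rewrite geq_max; first by rewrite andbF.
  rewrite ltnS => /andP[N1N N2N]; rewrite (le_trans (AB _))//.
  have := h1 _ N1N; have := h2 _ N2N; rewrite ler_pdivrMr// [e / 2 * _]mulrC.
  move=> k2 k1; rewrite (le_trans (lerD k1 k2))// -mulrDr -addrA.
  by rewrite ler_wpM2l//; lra.
apply/seteqP; split => u [uM uE].
  have {}uM : bounded_path u by apply/bE.
  split => //; have b0 := sqr_ge0 (\sum_(k < size p) normc p`_k * M).
  apply: main uE; first exact: b0.
  move=> N; rewrite sE.
  have := sq_error_le 0 uM; have := sq_error_ge0 p N%:Z u.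
  by rewrite /error_bound; lra.
split; first by apply/bE.
have b0 := sqr_ge0 (\sum_(k < size p) normc p`_k * M).
apply: main uE; first exact: b0.
move=> N; rewrite sE.
have := sq_error_le N%:Z uM; have := sq_error_ge0 p 0 u.
by rewrite /error_bound; lra.
Qed.

Lemma measurable_small_error_event : measurable small_error_event.
Proof.
have -> : small_error_event =
    (\bigcap_(n : int) [set u : paths | normc (u n) <= M]) `&`
    (\bigcap_(j : nat) \bigcup_(N0 : nat) \bigcap_(N : nat)
      [set u : paths | (N0 <= N)%N ->
        \sum_(n < N) sq_error p n%:Z u <= N%:R * (c + j.+1%:R^-1)]).
  apply/seteqP; split => u.
    move=> [uM uE]; split; first by move=> n _; exact: uM.
    move=> j _; have [|N0 h] := uE j.+1%:R^-1; first by rewrite invr_gt0.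
    by exists N0 => // N _ /=; exact: h.
  move=> [uM uE]; split; first by move=> n; exact: (uM n).
  move=> e e0; have [j hj] := inv_natS_small ler01 e0.
  have [N0 _ h] := uE j I; exists N0 => N N0N.
  rewrite (le_trans (h N I N0N))// ler_wpM2l// lerD2l.
  by have := hj j (leqnn j); rewrite mul1r.
apply: measurableI.
  rewrite (_ : \bigcap_(n : int) _ = ~` (\bigcup_(n : int)
      ~` [set u : paths | normc (u n) <= M])); last first.
    by rewrite setC_bigcup; apply: eq_bigcapr => n _; rewrite setCK.
  apply: measurableC; apply: countable_bigcupT_measurable => // n.
  apply: measurableC; rewrite -[X in measurable X]setTI.
  apply: measurable_fun_le => //.
  have -> : (fun u : paths => normc (u n)) = (fun u : paths => Num.sqrt
      (complex.Re (u n) ^+ 2 + complex.Im (u n) ^+ 2)).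
    by apply/funext => u; rewrite /Normc.normc; case: (u n).
  apply: measurableT_comp.
    apply: continuous_measurable_fun; exact: sqrt_continuous.
  apply: measurable_funD; apply: measurable_funX.
  - exact: measurableT_comp measurable_complex_Re (measurable_coordinate _).
  - exact: measurableT_comp measurable_complex_Im (measurable_coordinate _).
apply: bigcapT_measurable => j; apply: bigcupT_measurable => N0.
apply: bigcapT_measurable => N; have [N0N|NN0] := leqP N0 N.
  rewrite (_ : [set u | _] = [set u : paths |
    \sum_(n < N) sq_error p n%:Z u <= N%:R * (c + j.+1%:R^-1)]); last first.
    by apply/seteqP; split => u /=; [exact|].
  rewrite -[X in measurable X]setTI; apply: measurable_fun_le => //.
  by apply: measurable_sum => n; exact: measurable_sq_error.
rewrite (_ : [set u | _] = setT); first exact: measurableT.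
by apply/seteqP; split => u.
Qed.

End prediction_event.

Section stationary_process.
Context d (Omega : measurableType d) (R : realType) (P : probability Omega R).
Variable a : int -> {RV P >-> borelC R}.
Hypothesis a_invariant : translation_invariant a.
Variable M : R.
Hypothesis aM : forall n w, normc (a n w) <= M.

Lemma measurable_sample_path : measurable_fun setT (sample_path a).
Proof.
by apply: measurable_to_path => n; exact: (@measurable_funPT _ _ _ _ (a n)).
Qed.

Lemma bounded_sample_path w : bounded_path M (sample_path a w).
Proof. by move=> n; exact: aM. Qed.

Lemma integral_path_shift (g : path_space (borelC R) int -> R) :
  measurable_fun setT g -> (forall u, 0 <= g u) ->
  (\int[P]_w (g (path_shift (sample_path a w)))%:E =
   \int[P]_w (g (sample_path a w))%:E)%E.
Proof.
move=> mg g0.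
have mS := measurable_sample_path.
have mT : measurable_fun setT (fun w => path_shift (sample_path a w)).
  exact: measurableT_comp measurable_path_shift mS.
have mEg : measurable_fun setT (EFin \o g) by exact/measurable_EFinP.
have := @ge0_integral_pushforward _ _ _ _ R _ mS P setT (EFin \o g) measurableT mEg.
rewrite preimage_setT => <-; last by move=> u _; rewrite lee_fin.
have := @ge0_integral_pushforward _ _ _ _ R _ mT P setT (EFin \o g) measurableT mEg.
rewrite preimage_setT => <-; last by move=> u _; rewrite lee_fin.
apply: eq_measure_integral => B mB _.
exact: a_invariant mB.
Qed.

Variable p : {poly R[i]}.

Let err (n : int) (w : Omega) : R := sq_error p n (sample_path a w).

Let measurable_err n : measurable_fun setT (err n).
Proof.
exact: measurableT_comp (measurable_sq_error p n) measurable_sample_path.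
Qed.

Let err_ge0 n w : 0 <= err n w.
Proof. exact: sq_error_ge0. Qed.

Let err_le n w : err n w <= error_bound M p.
Proof. exact/sq_error_le/bounded_sample_path. Qed.

Lemma mean_sq_error_stationary (n : nat) :
  (\int[P]_w (err n%:Z w)%:E = \int[P]_w (err 0 w)%:E)%E.
Proof.
elim: n => [//|n <-].
rewrite -(integral_path_shift (measurable_sq_error p n%:Z)); last exact: sq_error_ge0.
apply: eq_integral => w _; congr EFin.
by rewrite sq_error_shift -PoszD addn1.
Qed.

(** Stationarity turns an almost sure bound on the time averages into a bound on
    the expectation, by dominated convergence. *)
Lemma mean_sq_error_le (c : R) : 0 <= c -> law a (small_error_event M p c) = 1%E ->
  (\int[P]_w (sq_error p 0 (sample_path a w))%:E <= c%:E)%E.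
Proof.
move=> c0 Ev1.
pose avg N w := N.+1%:R^-1 * \sum_(n < N.+1) err n%:Z w.
pose h N w := Num.max 0 (avg N w - c).
have m_avg N : measurable_fun setT (avg N).
  apply: measurable_funM => //; apply: measurable_sum => n.
  exact: measurable_err.
have m_h N : measurable_fun setT (h N).
  apply: measurable_maxr => //; exact: measurable_funB.
have avg_ge0 N w : 0 <= avg N w.
  by rewrite mulr_ge0 ?invr_ge0// sumr_ge0// => n _; exact: err_ge0.
have avg_le N w : avg N w <= error_bound M p.
  rewrite /avg mulrC ler_pdivrMr//.
  have -> : error_bound M p * N.+1%:R = \sum_(n < N.+1) error_bound M p.
    by rewrite sumr_const card_ord mulr_natr.
  by apply: ler_sum => n _; exact: err_le.
have h_ge0 N w : 0 <= h N w by rewrite le_max lexx.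
have h_le N w : h N w <= error_bound M p.
  rewrite ge_max (le_trans (err_ge0 0 w) (err_le 0 w)) /=.
  by rewrite (le_trans _ (avg_le N w))// gerBl.
have mEv := measurable_small_error_event M p c.
have h_cvg : {ae P, forall w, setT w -> (fun N => (h N w)%:E) @ \oo --> 0%E}.
  exists (~` (sample_path a @^-1` small_error_event M p c)); split.
  - by apply: measurableC; rewrite -[X in measurable X]setTI; exact: measurable_sample_path.
  - rewrite probability_setC; last first.
      by rewrite -[X in measurable X]setTI; exact: measurable_sample_path.
    by move: Ev1; rewrite /law /pushforward => ->; rewrite subee.
  - apply: subsetC => w [_ wE] _.
    apply: cvg_EFin; first by exact: nearW.
    apply/cvgrPdist_le => e e0; have [N0 hN0] := wE _ e0.
    exists N0 => // N /= N0N; rewrite sub0r normrN ger0_norm//.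
    rewrite ge_max (ltW e0) /= lerBlDr addrC /avg mulrC ler_pdivrMr//.
    by rewrite mulrC hN0// leqW.
have h_dom : {ae P, forall w N, setT w -> (`|(h N w)%:E| <= (error_bound M p)%:E)%E}.
  by apply: aeW => w N _; rewrite lee_fin ger0_norm.
have mhE N : measurable_fun setT (EFin \o h N) by exact/measurable_EFinP.
have c_int : P.-integrable setT (cst (error_bound M p)%:E).
  exact: finite_measure_integrable_cst.
have [_ _] := dominated_convergence measurableT mhE (measurable_cst 0%E)
  h_cvg c_int h_dom.
rewrite integral0 => hint.
pose E0 : \bar R := (\int[P]_w (err 0 w)%:E)%E.
have P1 (y : R) : (\int[P]_w y%:E = y%:E)%E.
  by rewrite integral_cst//= probability_setT mule1.
have mE n : measurable_fun setT (fun w => (err n w)%:E) by exact/measurable_EFinP.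
have E0_fin : E0 \is a fin_num.
  rewrite ge0_fin_numE; last by apply: integral_ge0 => w _; rewrite lee_fin.
  apply: (@le_lt_trans _ _ (\int[P]_w (error_bound M p)%:E)%E); last by rewrite P1 ltry.
  by apply: ge0_le_integral => //= w _; rewrite lee_fin.
have E_avg N : (\int[P]_w (avg N w)%:E = E0)%E.
  rewrite (eq_integral (fun w => (N.+1%:R^-1)%:E * (\sum_(n < N.+1) (err n%:Z w)%:E)))%E.
    rewrite ge0_integralZl_EFin ?invr_ge0//.
    - rewrite ge0_integral_sum//; last by move=> n w _; rewrite lee_fin.
      rewrite (eq_bigr (fun=> E0)); last by move=> n _; exact: mean_sq_error_stationary.
      rewrite -(fineK E0_fin) sumEFin sumr_const card_ord -EFinM.
      by rewrite -[fine E0 *+ _]mulr_natl mulKf// pnatr_eq0.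
    - by move=> w _; rewrite sume_ge0// => n _; rewrite lee_fin.
    - by apply: emeasurable_sum.
  by move=> w _; rewrite sumEFin -EFinM.
have E_le N : (E0 <= c%:E + \int[P]_w (h N w)%:E)%E.
  rewrite -(E_avg N) -[in leRHS](P1 c) -ge0_integralD//; last first.
  - exact: mhE.
  - by move=> w _; rewrite lee_fin.
  apply: ge0_le_integral => //=.
  - by move=> w _; rewrite lee_fin.
  - exact/measurable_EFinP.
  - by apply: emeasurable_funD => //; exact: mhE.
  - move=> w _; rewrite -EFinD lee_fin -lerBlDl.
    by rewrite le_max lexx orbT.
have lim_c : (fun N => c%:E + \int[P]_w (h N w)%:E)%E @ \oo --> (c%:E + 0)%E.
  by apply: cvgeD => //; exact: cvg_cst.
rewrite -[leRHS]adde0 -(cvg_lim _ lim_c)//.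
apply: lime_ge; last exact: nearW.
by apply/cvg_ex; exists (c%:E + 0)%E.
Qed.

End stationary_process.

(** * Determinism from small prediction errors *)

Section determinism.
Context d (Omega : measurableType d) (R : realType) (P : probability Omega R).
Variable a : int -> {RV P >-> borelC R}.
Variables (p : nat -> {poly R[i]}) (K : R).
Hypothesis p0 : forall m, (p m)`_0 = 1.
Hypothesis mean_le : forall m,
  (\int[P]_w (sq_error (p m) 0 (sample_path a w))%:E <= (K * 2^-1 ^+ m)%:E)%E.
Local Notation past_paths := (path_space (borelC R) nat).

(** The prediction of the present from the past that goes with [p m]: its error
    is the path filtered by [p m]. *)
Definition predictor (m : nat) (v : past_paths) : R[i] :=
  - \sum_(k < (size (p m)).-1) (p m)`_k.+1 * v k.

Lemma predictor_error m w :
  path_filter (p m) 0 (sample_path a w) = a 0 w - predictor m (past a w).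
Proof.
rewrite /path_filter /predictor opprK.
have : (0 < size (p m))%N.
  rewrite lt0n size_poly_eq0; apply/eqP => pm; have := p0 m.
  by move/eqP; rewrite pm coef0 eq_sym oner_eq0.
case: (size (p m)) => // n _; rewrite big_ord_recl /= p0 mul1r subr0.
by congr (_ + _); apply: eq_bigr => k _; rewrite sub0r.
Qed.

Lemma measurable_predictor_Re m :
  measurable_fun setT (fun v : past_paths => complex.Re (predictor m v)).
Proof.
have -> : (fun v : past_paths => complex.Re (predictor m v)) = (fun v : past_paths =>
    - \sum_(k < (size (p m)).-1)
      (complex.Re (p m)`_k.+1 * complex.Re (v k) -
       complex.Im (p m)`_k.+1 * complex.Im (v k))).
  apply/funext => v; rewrite /predictor.
  have -> (z : R[i]) : complex.Re (- z) = - complex.Re z by case: z.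
  rewrite Re_sum; congr (- _); apply: eq_bigr => k _.
  by case: ((p m)`_k.+1) => x y; case: (v k).
apply: measurableT_comp => //; apply: measurable_sum => k.
apply: measurable_funB; apply: measurable_funM => //.
- exact: measurableT_comp measurable_complex_Re (measurable_coordinate _).
- exact: measurableT_comp measurable_complex_Im (measurable_coordinate _).
Qed.

Lemma measurable_predictor_Im m :
  measurable_fun setT (fun v : past_paths => complex.Im (predictor m v)).
Proof.
have -> : (fun v : past_paths => complex.Im (predictor m v)) = (fun v : past_paths =>
    - \sum_(k < (size (p m)).-1)
      (complex.Re (p m)`_k.+1 * complex.Im (v k) +
       complex.Im (p m)`_k.+1 * complex.Re (v k))).
  apply/funext => v; rewrite /predictor.
  have -> (z : R[i]) : complex.Im (- z) = - complex.Im z by case: z.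
  rewrite Im_sum; congr (- _); apply: eq_bigr => k _.
  by case: ((p m)`_k.+1) => x y; case: (v k).
apply: measurableT_comp => //; apply: measurable_sum => k.
apply: measurable_funD; apply: measurable_funM => //.
- exact: measurableT_comp measurable_complex_Im (measurable_coordinate _).
- exact: measurableT_comp measurable_complex_Re (measurable_coordinate _).
Qed.

(** The upper limit is a measurable function of the past everywhere, also where
    the predictors diverge. *)
Definition limit_predictor (v : past_paths) : borelC R :=
  fine (limn_esup (fun m => (complex.Re (predictor m v))%:E)) +i*
  fine (limn_esup (fun m => (complex.Im (predictor m v))%:E)).

Lemma measurable_limit_predictor : measurable_fun setT limit_predictor.
Proof.
apply: measurable_fun_complex.
  apply: (measurableT_comp (@fine_measurable R setT measurableT)).
  apply: measurable_fun_limn_esup => m.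
  by apply/measurable_EFinP; exact: measurable_predictor_Re.
apply: (measurableT_comp (@fine_measurable R setT measurableT)).
apply: measurable_fun_limn_esup => m.
by apply/measurable_EFinP; exact: measurable_predictor_Im.
Qed.

Lemma limit_predictorE w :
  (fun m => sq_error (p m) 0 (sample_path a w)) @ \oo --> (0 : R) ->
  limit_predictor (past a w) = a 0 w.
Proof.
move=> /cvgrPdist_le h.
have err (e : R) : 0 < e -> \forall m \near \oo,
    normc (a 0 w - predictor m (past a w)) <= e.
  move=> e0; have := h _ (exprn_gt0 2 e0); apply: filterS => m.
  rewrite sub0r normrN ger0_norm ?sq_error_ge0// /sq_error predictor_error.
  by rewrite ler_sqr ?nnegrE ?normc_ge0// ltW.
have limRe : (fun m => (complex.Re (predictor m (past a w)))%:E) @ \oo -->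
    (complex.Re (a 0 w))%:E.
  apply: cvg_EFin; first exact: nearW.
  apply/cvgrPdist_le => e e0; have := err e e0; apply: filterS => m.
  exact: le_trans (Re_lipschitz _ _).
have limIm : (fun m => (complex.Im (predictor m (past a w)))%:E) @ \oo -->
    (complex.Im (a 0 w))%:E.
  apply: cvg_EFin; first exact: nearW.
  apply/cvgrPdist_le => e e0; have := err e e0; apply: filterS => m.
  exact: le_trans (Im_lipschitz _ _).
rewrite /limit_predictor !is_cvg_limn_esupE.
- by rewrite (cvg_lim _ limRe)// (cvg_lim _ limIm)//=; case: (a 0 w).
- by apply/cvg_ex; eexists; exact: limIm.
- by apply/cvg_ex; eexists; exact: limRe.
Qed.

(** The mean square errors are summable, hence almost surely so are the square
    errors themselves, and the predictors converge to the present. *)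
Lemma deterministic_of_predictors : deterministic a.
Proof.
exists limit_predictor; first exact: measurable_limit_predictor.
pose g m w := (sq_error (p m) 0 (sample_path a w))%:E.
have mg m : measurable_fun setT (g m).
  apply/measurable_EFinP.
  exact: measurableT_comp (measurable_sq_error _ _) (measurable_sample_path a).
have g0 m w : (0 <= g m w)%E by rewrite lee_fin sq_error_ge0.
have K0 : 0 <= K.
  have := mean_le 0; rewrite expr0 mulr1 -lee_fin; apply: le_trans.
  by apply: integral_ge0 => w _; exact: g0.
have total : (\int[P]_w (\sum_(0 <= m <oo) g m w) <= (K * 2)%:E)%E.
  rewrite integral_nneseries//.
  apply: lime_le.
    by apply: is_cvg_nneseries => m _ _; apply: integral_ge0 => w _; exact: g0.
  apply: nearW => n.
  apply: (@le_trans _ _ (\sum_(0 <= m < n) (K * 2^-1 ^+ m)%:E)%E).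
    by apply: lee_sum => m _; exact: mean_le.
  rewrite sumEFin lee_fin -mulr_sumr ler_wpM2l// big_mkord.
  have h : 0 <= (2^-1 : R) < 1 by rewrite invr_ge0 invf_lt1 ?ler0n ?ltr1n.
  have h2 : 1 - 2^-1 = 2^-1 :> R by lra.
  by rewrite (le_trans (geometric_sum_le n h))// h2 invrK.
have g_int : P.-integrable setT (fun w => (\sum_(0 <= m <oo) g m w)%E).
  apply/integrableP; split.
    exact: ge0_emeasurable_sum.
  apply: le_lt_trans (ltry (K * 2)); apply: le_trans total.
  rewrite (eq_integral (fun w => \sum_(0 <= m <oo) g m w)%E)//.
  by move=> w _; rewrite gee0_abs// nneseries_ge0.
have := integrable_ae measurableT g_int; apply: filterS => w /(_ I) fin.
apply/esym/limit_predictorE.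
apply: (@cvg_series_cvg_0 _ R^o); apply: nondecreasing_is_cvgn.
  by apply/nondecreasing_seqP => n; rewrite seriesSr lerDl sq_error_ge0.
exists (fine (\sum_(0 <= m <oo) g m w)%E) => _ [n _ <-].
rewrite -lee_fin fineK// /series /= -sumEFin.
by apply: nneseries_lim_ge => m _ _; exact: g0.
Qed.

End determinism.

(** * Arcs of the circle *)

Section arcs.
Context {R : realType}.
Implicit Types (s t x : R).

Lemma expi_add_2pi x (m : int) : expi (x + m%:~R * (2 * pi)) = expi x.
Proof. by rewrite expiD expi_2pi mulr1. Qed.

(** Hence countably many arcs suffice. A multiple of [2 * pi] brings the midpoint
    into the fundamental domain, whose interior the translated arc then meets. *)
Lemma open_arc_rat (I : set R[i]) : open_arc I ->
  exists q : rat * rat, [/\ 0 < ratr q.1 :> R, ratr q.1 < ratr q.2 :> R,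
    ratr q.2 < 2 * pi :> R &
    forall x, ratr q.1 <= x <= ratr q.2 -> I (expi x)].
Proof.
move=> [s [t [st ->]]].
have p0 : (0 : R) < 2 * pi by rewrite mulr_gt0// pi_gt0.
pose u := (s + t) / 2; pose m := Num.floor (u / (2 * pi)).
pose c : R := m%:~R * (2 * pi).
have yI : 0 <= u - c < 2 * pi.
  have := floor_itv (u / (2 * pi)); rewrite -/m => /andP[h1 h2].
  rewrite subr_ge0 -ler_pdivlMr// h1 /= ltrBlDr.
  by move: h2; rewrite ltr_pdivrMr// intrD mulrDl mul1r addrC.
have /andP[y0 y2] := yI.
pose l := Num.max 0 (s - c); pose r := Num.min (2 * pi) (t - c).
have lr : l < r.
  by rewrite /l /r gt_max !lt_min p0 /u in y0 y2 *; apply/andP; split;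
    apply/andP; split; lra.
have [|q1] := @rat_in_itvoo R l r; first exact: lr.
rewrite in_itv /= => /andP[lq1 q1r].
have [|q2] := @rat_in_itvoo R (ratr q1) r; first exact: q1r.
rewrite in_itv /= => /andP[q12 q2r].
move: lq1 q2r; rewrite /l /r gt_max lt_min => /andP[h1 h2] /andP[h3 h4].
exists (q1, q2); split => //= x /andP[x1 x2].
exists (x + c); last by rewrite expi_add_2pi.
by rewrite /= in_itv /=; apply/andP; split; lra.
Qed.

Lemma open_preimage_arc (I : set R[i]) : open_arc I -> open [set x : R | I (expi x)].
Proof.
move=> [s [t [st ->]]]; rewrite openE => x /= [y yst yx].
apply/nbhs_ballP; move: yst; rewrite /= in_itv /= => /andP[sy yt].
exists (Num.min (y - s) (t - y)); first by rewrite /= lt_min !subr_gt0 sy yt.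
move=> z; rewrite -ball_normE /ball_ /= lt_min !ltr_norml => /andP[/andP[h1 h2] /andP[h3 h4]].
exists (y + (z - x)); last by rewrite expiD yx -expiD addrC subrK.
by rewrite /= in_itv /=; apply/andP; split; lra.
Qed.

Lemma rint_bump_le s t (h : R -> R) (C : R) : 0 <= s -> s < t -> t <= 2 * pi ->
  continuous h -> (forall x, 0 <= h x) ->
  (\int[lebesgue_measure]_(x in `[s, t]) (h x)%:E <= C%:E)%E ->
  rint (fun x => bump s t x * h x) <= (t - s) ^+ 2 * C.
Proof.
move=> s0 st t2 hc h0 hC; rewrite rint_bump//.
have int_h := integrable_itv_continuous s t hc.
have bc : continuous (fun x : R => (x - s) * (t - x)).
  by apply: continuous_mulf; apply: continuous_subf => x;
    (exact: cvg_id || exact: cvg_cst).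
have cc : continuous (fun _ : R => (t - s) ^+ 2) by move=> x; exact: cvg_cst.
apply: (@le_trans _ _ (\int[lebesgue_measure]_(x in `[s, t]) ((t - s) ^+ 2 * h x))).
  apply: le_Rintegral => //.
  - exact/integrable_itv_continuous/continuous_mulf.
  - exact/integrable_itv_continuous/continuous_mulf.
  - move=> x; rewrite /= => xst; rewrite ler_wpM2r//.
    by rewrite -(bump_in xst) bump_le.
rewrite RintegralZl// ler_wpM2l ?sqr_ge0// -lee_fin /Rintegral fineK//.
exact: integrable_fin_num.
Qed.

(** The bump is at most [(t - s) ^+ 2] and is carried by [[s, t]], which the
    arc contains. *)
Lemma bounded_weighted_means (M s t : R) (c : nat -> R[i]) (I : set R[i]) :
  bounded_coefs M c -> open_arc I -> 0 < s -> s < t -> t < 2 * pi ->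
  (forall x, s <= x <= t -> I (expi x)) ->
  ereal_sup [set circle_mean_on (power_series c) I r | r in `]0, 1[] != +oo%E ->
  exists C1, forall r : R, 0 < r < 1 ->
    rint (fun x => bump s t x * normc (power_series c (r%:C * expi x))) <= C1.
Proof.
move=> cM arcI s0 st t2 sub; set S := ereal_sup _ => S_oo.
have p0 : (0 : R) < 2 * pi by rewrite mulr_gt0// pi_gt0.
exists ((t - s) ^+ 2 * (2 * pi * fine S)) => r r01.
pose h x := normc (power_series c (r%:C * expi x)).
have hc : continuous h by exact: continuous_normc_power_series r01 cM.
have h0 x : 0 <= h x by exact: normc_ge0.
have meanS : (circle_mean_on (power_series c) I r <= S)%E.
  by apply: ereal_sup_ubound; exists r => //; rewrite /= in_itv.
have mean0 : (0 <= circle_mean_on (power_series c) I r)%E.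
  by apply: integral_ge0 => x _; rewrite lee_fin divr_ge0 ?normc_ge0// ltW.
have Sfin : S \is a fin_num.
  by rewrite ge0_fin_numE ?ltey// (le_trans mean0 meanS).
apply: rint_bump_le => //; try exact: ltW.
have hdE (A : set R) : measurable A ->
    (\int[lebesgue_measure]_(x in A) (h x)%:E =
     (2 * pi)%:E * \int[lebesgue_measure]_(x in A) (h x / (2 * pi))%:E)%E.
  move=> mA; rewrite -ge0_integralZl_EFin//; last 3 first.
  - by move=> x _; rewrite lee_fin divr_ge0// ltW.
  - apply/measurable_EFinP; apply: measurable_funTS.
    by apply: measurable_funM => //; exact: continuous_measurable_fun.
  - exact: ltW.
  by apply: eq_integral => x _; rewrite -EFinM mulrC divfK// gt_eqF.
rewrite hdE// [in leRHS]EFinM lee_pmul2l ?lte_fin// fineK//.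
apply: le_trans meanS; apply: ge0_subset_integral.
- exact: measurable_itv.
- have -> : [set x : R | 0 <= x < 2 * pi /\ I (expi x)] =
    `[0, 2 * pi[ `&` [set x | I (expi x)].
    by apply/seteqP; split => x /=; rewrite in_itv.
  apply: measurableI; first exact: measurable_itv.
  by apply: open_measurable; exact: open_preimage_arc.
- apply/measurable_EFinP; apply: measurable_funTS.
  by apply: measurable_funM => //; exact: continuous_measurable_fun.
- by move=> x _; rewrite lee_fin divr_ge0// ltW.
- move=> x /=; rewrite in_itv /= => xst; have /andP[h1 h2] := xst.
  split; last exact: sub.
  by rewrite (le_trans (ltW s0) h1) (le_lt_trans h2 t2).
Qed.

End arcs.

(** * The almost sure statement *)

Section almost_sure.
Context d (Omega : measurableType d) (R : realType) (P : probability Omega R).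
Variable a : int -> {RV P >-> borelC R}.
Hypotheses (a_invariant : translation_invariant a) (a_ergodic : ergodic a).
Hypothesis a_nondeterministic : nondeterministic a.
Variable M : R.
Hypothesis aM : forall n w, normc (a n w) <= M.

Definition future (w : Omega) (n : nat) : R[i] := a n%:Z w.

Definition bounded_on_arc (s t : R) (w : Omega) : Prop :=
  exists C1, forall r : R, 0 < r < 1 ->
    rint (fun x => bump s t x * normc (power_series (future w) (r%:C * expi x))) <= C1.

Lemma future_bounded w : bounded_coefs M (future w).
Proof. by move=> n; exact: aM. Qed.

(** Off the middle third of the arc the polynomial is small, and on the middle
    third the bump is bounded below. *)
Lemma poly_le_bump (s t e : R) : 0 <= s -> s < t -> t <= 2 * pi -> 0 < e ->
  exists p : {poly R[i]}, p`_0 = 1 /\ exists2 K : R, 0 <= K &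
    forall x, 0 <= x <= 2 * pi -> normc p.[expi x] ^+ 2 <= e ^+ 2 + K * bump s t x.
Proof.
move=> s0 st t2 e0; pose h := (t - s) / 3.
have h0 : 0 < h by rewrite divr_gt0// subr_gt0.
have [||||p p0 hp] := @small_poly_off_arc R (s + h) (t - h) e => //.
- by rewrite addr_ge0// ltW.
- by rewrite /h; lra.
- by rewrite /h; lra.
exists p; split => //; pose B := \sum_(i < size p) normc p`_i.
have hh : 0 < h * h by rewrite mulr_gt0.
exists (B ^+ 2 / (h * h)); first by rewrite divr_ge0 ?sqr_ge0// ltW.
move=> x xI; have [xin|xout] := boolP (x \in `]s + h, t - h[); last first.
  rewrite (le_trans (y := e ^+ 2))//.
    by rewrite ler_sqr ?nnegrE ?normc_ge0 ?(ltW e0)// hp.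
  by rewrite lerDl mulr_ge0 ?bump_ge0// divr_ge0 ?sqr_ge0// ltW.
have pB : normc p.[expi x] <= B.
  rewrite horner_coef (le_trans (normc_sum _ _ _))//; apply: ler_sum => i _.
  by rewrite normc_mul normc_exp normc_expi expr1n mulr1.
have bh : h * h <= bump s t x.
  have := @bump_ge R s t (s + h) (t - h) x; rewrite addrAC subrr add0r opprB addrCA subrr addr0.
  by apply => //; rewrite /h; lra.
rewrite (le_trans (y := B ^+ 2))//.
  by rewrite ler_sqr ?nnegrE ?normc_ge0// (le_trans _ pB)// normc_ge0.
rewrite ler_wpDl ?sqr_ge0// -mulrA ler_peMr ?sqr_ge0//.
by rewrite mulrC ler_pdivlMr// mul1r.
Qed.

Lemma small_error_of_bounded_on_arc (s t e K : R) (p : {poly R[i]}) (w : Omega) :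
  0 <= s -> s < t -> t <= 2 * pi -> 0 <= K ->
  (forall x, 0 <= x <= 2 * pi -> normc p.[expi x] ^+ 2 <= e ^+ 2 + K * bump s t x) ->
  bounded_on_arc s t w ->
  small_error_event M p (e ^+ 2 * M ^+ 2) (sample_path a w).
Proof.
move=> s0 st t2 K0 pK [C1 mean_le]; split; first exact: bounded_sample_path.
move=> d0 d0_gt0; have d2 : 0 < d0 / 2 by rewrite divr_gt0.
have [N1 hN1] := filtered_mean_square s0 st t2 (future_bounded w) mean_le K0 pK d2.
have A0 : 0 <= (size p)%:R * error_bound M p by rewrite mulr_ge0// sqr_ge0.
have [N2 hN2] := inv_natS_small A0 d2.
exists (maxn (size p) (maxn N1 N2.+1)) => -[|N].
  by rewrite !geq_max !andbF.
rewrite !geq_max ltnS => /and3P[pN N1N N2N].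
rewrite -(big_mkord predT (fun n => sq_error p n%:Z (sample_path a w))).
rewrite (big_cat_nat (n := size p))//=.
have h1 : \sum_(0 <= n < size p) sq_error p n%:Z (sample_path a w) <=
    N.+1%:R * (d0 / 2).
  apply: (@le_trans _ _ ((size p)%:R * error_bound M p)).
    have -> : (size p)%:R * error_bound M p = \sum_(0 <= n < size p) error_bound M p.
      by rewrite sumr_const_nat subn0 mulr_natl.
    apply: ler_sum => n _; apply: sq_error_le; exact: bounded_sample_path.
  by have := hN2 N N2N; rewrite ler_pdivrMr// [d0 / 2 * _]mulrC.
have h2 : \sum_(size p <= n < N.+1) sq_error p n%:Z (sample_path a w) <=
    N.+1%:R * (e ^+ 2 * M ^+ 2 + d0 / 2).
  apply: le_trans (hN1 _ N1N); rewrite !big_nat; apply: ler_sum => n /andP[pn _].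
  suff -> : sq_error p n%:Z (sample_path a w) =
    normc (filtered p (future w) n) ^+ 2 by [].
  rewrite /sq_error; congr (normc _ ^+ 2); apply: eq_bigr => k _.
  by rewrite /sample_path /future -subzn// (leq_trans (ltnW (ltn_ord k)) pn).
rewrite (le_trans (lerD h1 h2))// -mulrDr ler_wpM2l//.
by lra.
Qed.

(** A path that is bounded on the arc lies in all the events that its filtered
    versions are small. These are invariant, hence of probability zero or one. If
    one of them is null, then so is the set of these paths; otherwise the errors
    of the predictors tend to zero in quadratic mean, and the process would be
    deterministic. *)
Lemma ae_not_bounded_on_arc (s t : R) : 0 < s -> s < t -> t < 2 * pi ->
  {ae P, forall w, ~ bounded_on_arc s t w}.
Proof.
move=> s0 st t2.
have e0 (m : nat) : 0 < 2^-1 ^+ m :> R by rewrite exprn_gt0.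
have /choice[p hp] : forall m : nat, exists p : {poly R[i]}, p`_0 = 1 /\
    exists2 K : R, 0 <= K & forall x, 0 <= x <= 2 * pi ->
      normc p.[expi x] ^+ 2 <= (2^-1 ^+ m) ^+ 2 + K * bump s t x.
  by move=> m; apply: poly_le_bump => //; exact: ltW.
pose c (m : nat) : R := (2^-1 ^+ m) ^+ 2 * M ^+ 2.
pose Ev m := small_error_event M (p m) (c m).
have mEv m : measurable (Ev m) by exact: measurable_small_error_event.
have [[m Ev0]|/forallNP allEv] := pselect (exists m, law a (Ev m) = 0%E).
  exists (sample_path a @^-1` Ev m); split.
  - rewrite -[X in measurable X]setTI.
    exact: measurable_sample_path.
  - exact: Ev0.
  - move=> w /= /contrapT bad; have [_ [K K0 pK]] := hp m.
    exact: small_error_of_bounded_on_arc (ltW s0) st (ltW t2) K0 pK bad.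
exfalso; apply: a_nondeterministic.
apply: (deterministic_of_predictors (p := p) (K := M ^+ 2)).
  by move=> m; have [] := hp m.
move=> m; have [/allEv//|Ev1] := a_ergodic (mEv m) (small_error_event_shift M (p m) (c m)).
have c0 : 0 <= c m by rewrite mulr_ge0 ?sqr_ge0.
apply: (le_trans (mean_sq_error_le a_invariant aM c0 Ev1)).
rewrite lee_fin /c mulrC ler_wpM2l ?sqr_ge0// expr2 ler_piMl ?(ltW (e0 m))//.
by rewrite exprn_ile1// ?invr_ge0 ?invf_le1// ler1n.
Qed.

End almost_sure.

Theorem theorem1p7 (d : measure_display) (Omega : measurableType d)
  (R : realType) (P : probability Omega R)
  (a : int -> {RV P >-> borelC R})
  (a_invariant : translation_invariant a)
  (a_ergodic : ergodic a)
  (a_nondeterministic : nondeterministic a)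
  (a_bounded : exists M : R, forall n w, (Normc.normc (a n w) <= M)%R) :
  {ae P, forall w, strong_natural_boundary (power_series (fun n : nat => a n%:Z w))}.
Proof.
have [M aM] := a_bounded.
have ae_arc (j : nat) : {ae P, forall w, forall q : rat * rat, unpickle j = Some q ->
    0 < ratr q.1 :> R -> ratr q.1 < ratr q.2 :> R -> ratr q.2 < 2 * pi :> R ->
    ~ bounded_on_arc a (ratr q.1) (ratr q.2) w}.
  have [[q ->]|nq] := pselect (exists q : rat * rat, unpickle j = Some q); last first.
    by apply: aeW => w q jq; exfalso; apply: nq; exists q.
  have [[[q1 q2] q3]|nq] := pselect ((0 < ratr q.1 :> R /\
      ratr q.1 < ratr q.2 :> R) /\ ratr q.2 < 2 * pi :> R).
    have := ae_not_bounded_on_arc a_invariant a_ergodic a_nondeterministic aM q1 q2 q3.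
    by apply: filterS => w bad _ [<-].
  by apply: aeW => w _ [<-] q1 q2 q3; exfalso; apply: nq.
have : {ae P, forall w, forall (j : nat) (q : rat * rat), unpickle j = Some q ->
    0 < ratr q.1 :> R -> ratr q.1 < ratr q.2 :> R -> ratr q.2 < 2 * pi :> R ->
    ~ bounded_on_arc a (ratr q.1) (ratr q.2) w} by exact/ae_foralln.
apply: filterS => w good; split.
  exact: power_series_analytic (future_bounded aM w).
move=> I arcI; apply/eqP; apply: contrapT => /negP S_oo.
have [q [q1 q2 q3 sub]] := open_arc_rat arcI.
apply: (good (pickle q) q (pickleK q) q1 q2 q3).
exact: bounded_weighted_means (future_bounded aM w) arcI q1 q2 q3 sub S_oo.
Qed.
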